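(* Let $m,n$ be positive integers and assume that all parameters $q,s,x_1,\dots,x_m,y_1,\dots,y_n$ are complex numbers in the open unit disc. Then $$ \sum_{\lambda} \mathbb{F}_{\lambda}(x_1,\dots,x_m)\, \mathbb{F}^{*}_{\lambda}(y_1,\dots,y_n) = \prod_{i=1}^{m}\prod_{j=1}^{n} \frac{(-sx_i;q)_{\infty}(-sy_j;q)_{\infty}}{(s^2;q)_{\infty}(x_iy_j;q)_{\infty}}, $$ where the sum is over all (positive) partitions $\lambda$.
   Context: Fix $q,s\in\mathbb{C}$ with $|q|<1$, $|s|<1$. Write $(a;q)_m=\prod_{i=1}^m(1-aq^{i-1})$ for $m\ge 1$, $(a;q)_0=1$, $(a;q)_\infty=\prod_{i\ge1}(1-aq^{i-1})$. A (positive) partition is a finite, possibly empty, sequence $\lambda_1\ge\dots\ge\lambda_\ell\ge1$ of integers, with $\lambda_i:=0$ for $i>\ell$. Vertex weights: for $x\in\mathbb{C}$ and $i,j,k,\ell\in\mathbb{Z}_{\ge0}$, $$W_x(i,j;k,\ell)=\mathbf 1_{i+j=k+\ell}\,\mathbf 1_{i\ge\ell}\;x^\ell\frac{(-s/x;q)_\ell\,(-sx;q)_{i-\ell}\,(q;q)_k}{(q;q)_\ell\,(q;q)_{i-\ell}\,(s^2;q)_k},$$ where $x^\ell(-s/x;q)_\ell$ is read as the polynomial $\prod_{r=0}^{\ell-1}(x+sq^r)$. ($i,j,k,\ell$ are the numbers of paths on the bottom, left, top, right edges of the vertex.) Skew spin $q$-Whittaker polynomial: for partitions $\lambda,\mu$,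 $$\mathbb{F}_{\lambda/\mu}(x_1,\dots,x_n)=\sum\prod_{r=1}^n\left[x_r^{h_{r,0}}\frac{(-s/x_r;q)_{h_{r,0}}}{(q;q)_{h_{r,0}}}\prod_{c\ge1}W_{x_r}\big(v_{r-1,c},h_{r,c-1};v_{r,c},h_{r,c}\big)\right],$$ the sum running over all non-negative integers $h_{r,c}$ ($1\le r\le n$, $c\ge0$), with $h_{r,c}=0$ for all large $c$, and $v_{r,c}$ ($0\le r\le n$, $c\ge1$) subject to $v_{0,c}=\mu_c-\mu_{c+1}$ and $v_{n,c}=\lambda_c-\lambda_{c+1}$; all but finitely many vertex weights equal $W_x(0,0;0,0)=1$ in any nonzero term. (Equivalently: the partition function on columns $0,1,2,\dots$ and rows $1,\dots,n$ numbered from bottom to top, row $r$ carrying $x_r$, all left and right boundary edges empty, infinitely many paths in column $0$ with weights $W_x(\infty,0;\infty,\ell)=x^\ell\frac{(-s/x;q)_\ell(-sx;q)_\infty}{(q;q)_\ell(s^2;q)_\infty}$, divided by $\prod_{i=1}^n(-sx_i;q)_\infty/(s^2;q)_\infty$.) Put $\mathbb{F}_\lambda=\mathbb{F}_{\lambda/\varnothing}$. Dual polynomials: $$\mathbb{F}^*_{\lambda}(x_1,\dots,x_n)=\prod_{i\ge1}\frac{(s^2;q)_{\lambda_i-\lambda_{i+1}}}{(q;q)_{\lambda_i-\lambda_{i+1}}}\;\mathbb{F}_{\lambda}(x_1,\dots,x_n).$$ *)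

(* Defs.v *)
(* The complex numbers are R[i] over an arbitrary R : realType; the alias
   R[i]^o only serves to let type inference find the topology. *)
From mathcomp Require Import all_boot all_order all_algebra finmap.
From mathcomp Require Import all_classical all_reals all_analysis.
From mathcomp Require Import complex.
From mathcomp Require Export showcase.summability.
Import Order.TTheory GRing.Theory Num.Theory numFieldNormedType.Exports.

Set Implicit Arguments.
Unset Strict Implicit.
Unset Printing Implicit Defensive.

Local Open Scope classical_set_scope.
Local Open Scope ring_scope.

(* lambda_i is [nth 0 la i.-1]; the default value 0 is the convention
   lambda_i = 0 beyond the length. *)
Definition is_partition (la : seq nat) : bool :=
  sorted geq la && (0%N \notin la).

Definition partition_type := {la : seq nat | is_partition la}.

(* mult la c = lambda_(c+1) - lambda_(c+2) in 1-based notation; the truncated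
   subtraction is exact because la is nonincreasing. *)
Definition mult (la : seq nat) (c : nat) : nat :=
  (nth 0 la c - nth 0 la c.+1)%N.

Section SpinqWhittaker.
Variables (R : realType) (q s : R[i]).

Definition qpoch (a : R[i]) (m : nat) : R[i] :=
  \prod_(i < m) (1 - a * q ^+ i).

Definition qpoch_inf (a : R[i]) : R[i] :=
  limn (fun m => qpoch a m : R[i]^o).

(* The polynomial x^l (-s/x;q)_l. *)
Definition spin_power (x : R[i]) (l : nat) : R[i] :=
  \prod_(r < l) (x + s * q ^+ r).

(* i, j, k, l: numbers of paths on the bottom, left, top, right edges. *)
Definition vertex_weight (x : R[i]) (i j k l : nat) : R[i] :=
  if ((i + j == k + l) && (l <= i))%N then
    spin_power x l *
    (qpoch (- (s * x)) (i - l) * qpoch q k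
      / (qpoch q l * qpoch q (i - l) * qpoch (s ^+ 2) k))
  else 0.

(* Edge configurations (h, v) on n rows.  Rows are indexed from 0, so that row
   r : 'I_n has bottom edges [v (widen_ord _ r)] and top edges
   [v (lift ord0 r)].  Horizontal edges h r c are indexed by c >= 0 as usual,
   whereas v r c is the vertical edge of column c.+1. *)
Definition configuration (n : nat) : Type :=
  (('I_n -> nat -> nat) * ('I_n.+1 -> nat -> nat))%type.

Definition admissible (n : nat) (la mu : seq nat) : set (configuration n) :=
  [set hv | [/\ exists N : nat, forall r c, (N <= c)%N -> hv.1 r c = 0%N,
                forall c, hv.2 ord0 c = mult mu c
              & forall c, hv.2 ord_max c = mult la c]].

(* The infinite product over the columns is the limit of its partial products;
   in a configuration of nonzero weight they are eventually constant. *)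
Definition row_weight (x : R[i]) (bot hor top : nat -> nat) : R[i] :=
  spin_power x (hor 0%N) / qpoch q (hor 0%N) *
  limn (fun N => (\prod_(c < N)
    vertex_weight x (bot c) (hor c) (top c) (hor c.+1)) : R[i]^o).

Definition config_weight (n : nat) (x : 'I_n -> R[i])
    (hv : configuration n) : R[i] :=
  \prod_(r < n) row_weight (x r) (hv.2 (widen_ord (leqnSn n) r)) (hv.1 r)
                           (hv.2 (lift ord0 r)).

(* Only finitely many admissible configurations have nonzero weight: a nonzero
   weight forces v_(r,c) + h_(r,c) = v_(r-1,c) + h_(r,c-1) and
   h_(r,c) <= v_(r-1,c) at every vertex, and the vertical paths on top are
   prescribed by la.  So the finitely supported sum below is the full sum. *)
Definition skewF (n : nat) (la mu : seq nat) (x : 'I_n -> R[i]) : R[i] :=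
  \sum_(hv \in admissible la mu) config_weight x hv.

Definition spinF (n : nat) (la : seq nat) (x : 'I_n -> R[i]) : R[i] :=
  skewF la [::] x.

(* The factors with i >= size la are equal to 1. *)
Definition spinF_dual (n : nat) (la : seq nat) (x : 'I_n -> R[i]) : R[i] :=
  (\prod_(i < size la) (qpoch (s ^+ 2) (mult la i) / qpoch q (mult la i)))
  * spinF la x.

End SpinqWhittaker.

(* Main.v *)
(* A row of capacity one ("thin" row) with spectral parameter y does two
   things.  Put on top of a dual row of parameter y, it turns it into a dual row
   of parameter q y (fusion).  Moved across a row of parameter x of the spin
   q-Whittaker model, it produces the factor (1 - x y) / (1 + s y) (Yang-Baxter
   equation), and it acts trivially on the empty partition; hence
   F_lambda(x_1, ..., x_m) is an eigenfunction of it.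
   Let E(y) be the Cauchy sum as a function of one dual variable y.  The two facts
   give E(q y) = (prod_i (1 - x_i y) / (1 + s y)) E(y).  Iterating and using the
   continuity of E at 0 yields
     E(0) = (prod_i (x_i y; q)_oo / (- s y; q)_oo) E(y).
   At y = - s a dual row is the identity, so E(- s) is the Cauchy sum with one dual
   variable less; comparing the values at y and at - s removes the variable y. *)
Require Import Defs.
From mathcomp Require Import all_boot all_order all_algebra finmap.
From mathcomp Require Import all_classical all_reals all_analysis.
From mathcomp Require Import complex ring lra zify.
Import Order.TTheory GRing.Theory Num.Theory numFieldNormedType.Exports.

Set Implicit Arguments.
Unset Strict Implicit.
Unset Printing Implicit Defensive.

Local Open Scope classical_set_scope.
Local Open Scope ring_scope.

(** * Vertex weights and the Yang-Baxter equation *)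

(** Both facts about thin rows concern sums over all partitions, whereas every sum below is cut to
    sequences of N entries smaller than B, and B then tends to infinity. Fusion is exact on such a
    box, because the intermediate partition lies below the top one. The exchange relation is not: a
    thin row can raise a part by one, so it needs a box with one more value per entry. The surplus
    consists of partitions outside the smaller box, on which F decays geometrically in the first
    part. So the functional equation for E holds only in the limit. The bounds are uniform on |y| <=
    rho < 1, which is what continuity at 0 requires. Capacity one keeps each side of every local
    identity to at most two terms, so each is an identity of rational functions instead of a
    q-hypergeometric summation. The number N of entries exceeds the number m of variables x, so that
    the last entry is 0 wherever F is nonzero. The value - s of the dual variable is the zero of y +
    s, the first factor in the weight of every nonempty horizontal edge. *)

Lemma big_nat_pair (F : fieldType) (B u : nat) (phi : nat -> F) :
  (u.+1 < B)%N -> (forall k, ~~ (u <= k <= u.+1)%N -> phi k = 0) ->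
  \sum_(0 <= k < B) phi k = phi u + phi u.+1.
Proof.
move=> uB phi0; rewrite big_mkord.
rewrite (bigD1 (Ordinal (ltnW uB))) //= (bigD1 (Ordinal uB)) /=; last first.
  by rewrite -val_eqE /=; lia.
rewrite big1 ?addr0 // => i /andP[]; rewrite -!val_eqE /= => i1 i2.
by apply: phi0; lia.
Qed.

Lemma big_nat_single (F : fieldType) (B u : nat) (phi : nat -> F) :
  (u < B)%N -> (forall k, k != u -> phi k = 0) ->
  \sum_(0 <= k < B) phi k = phi u.
Proof.
move=> uB phi0; rewrite big_mkord.
rewrite (bigD1 (Ordinal uB)) //= big1 ?addr0 // => i; rewrite -val_eqE /=.
exact: phi0.
Qed.

Section LocalWeights.
Variables (F : fieldType) (q s : F).

(** [hweight], [gapweight] and [topweight] are the factors of W_x(i,j;k,l), taken at l, at i - l and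
    at k. They are plain products over any field, since the local identities need only nonvanishing
    denominators. *)
Definition hweight (x : F) (k : nat) : F :=
  (\prod_(r < k) (x + s * q ^+ r)) / \prod_(i < k) (1 - q * q ^+ i).

Definition gapweight (x : F) (k : nat) : F :=
  (\prod_(i < k) (1 - - (s * x) * q ^+ i)) / \prod_(i < k) (1 - q * q ^+ i).

Definition topweight (k : nat) : F :=
  (\prod_(i < k) (1 - q * q ^+ i)) / \prod_(i < k) (1 - s ^+ 2 * q ^+ i).

(* The truncation makes every weight vanish on configurations which do not
   interlace. *)
Definition dif (phi : nat -> F) (a b : nat) : F :=
  if (b <= a)%N then phi (a - b)%N else 0.

Lemma dif_add (phi : nat -> F) (a b : nat) : dif phi (a + b) a = phi b.
Proof. by rewrite /dif leq_addr addKn. Qed.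

Lemma dif_lt (phi : nat -> F) (a b : nat) : (a < b)%N -> dif phi a b = 0.
Proof. by rewrite /dif ltnNge => /negbTE ->. Qed.

(* The dual weights of a row with at most one path on each horizontal edge: v paths
   at the bottom, a on the left, b on the right.  The path that leaves column 0
   has weight - y (see thin_left). *)
Definition thin_vertex (y : F) (v : nat) (a b : bool) : F :=
  (match a, b with
   | false, false => 1 + s * y * q ^+ v
   | false, true => - y * (1 - q ^+ v)
   | true, false => 1 - s ^+ 2 * q ^+ v
   | true, true => - (y + s * q ^+ v)
   end) / (1 + s * y).

(* Here mu is below and kappa above the thin row; u, u' are consecutive parts of mu
   and k, k' the corresponding parts of kappa. *)
Definition thin (y : F) (k u k' u' : nat) : F :=
  if [&& u' <= u, u <= k <= u.+1 & u' <= k' <= u'.+1]%N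
  then thin_vertex y (u - u') (u < k)%N (u' < k')%N else 0.

(** Column 0 contains infinitely many paths: the two weights are those of [thin_vertex] without a
    path on the left, with q^v replaced by 0 and the denominator 1 + s y dropped. *)
Definition thin_left (y : F) (k u : nat) : F :=
  if k == u then 1 else if k == u.+1 then - y else 0.

(** The R-matrix of a line of capacity one, with edges a and b, crossing a line of unbounded
    capacity. The latter carries H paths on one side and, by conservation, H + b - a on the other.
    The empty crossing has weight 1. *)
Definition Rvertex (x y : F) (a : bool) (H : nat) (b : bool) : F :=
  (match a, b with
   | false, false => 1 + s * y * q ^+ H
   | false, true => - y * (x + s * q ^+ H)
   | true, false => 1 - q ^+ H
   | true, true => q ^+ H - x * y
   end) / (1 + s * y).

(* Entry at the cut where lambda, mu have the parts l, u: the two-row configurations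
   lambda -> kappa -> mu and lambda -> nu -> mu have there the parts k and n, and
   the horizontal edges carry k - l and k - u, respectively u - n and l - n. *)
Definition Rmat (x y : F) (l u k n : nat) : F :=
  if [&& u <= k <= u.+1, n <= l <= n.+1, l <= k & n <= u]%N
  then Rvertex x y (u < k)%N (k - l) (n < l)%N else 0.

Hypothesis q_gen : forall k, 1 - q ^+ k.+1 != 0.
Hypothesis s_gen : forall k, 1 - s ^+ 2 * q ^+ k != 0.

Lemma hweight0 x : hweight x 0 = 1.
Proof. by rewrite /hweight !big_ord0 divr1. Qed.

Lemma prodq_neq0 k : \prod_(i < k) (1 - q * q ^+ i) != 0.
Proof. by apply/prodf_neq0 => i _; rewrite -exprS. Qed.

Lemma prods_neq0 k : \prod_(i < k) (1 - s ^+ 2 * q ^+ i) != 0.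
Proof. by apply/prodf_neq0. Qed.

Lemma hweightS x k :
  hweight x k.+1 = hweight x k * (x + s * q ^+ k) / (1 - q ^+ k.+1).
Proof.
rewrite /hweight !big_ord_recr /= -exprS; field.
by rewrite prodq_neq0 andbT exprS -exprS q_gen.
Qed.

Lemma gapweight0 x : gapweight x 0 = 1.
Proof. by rewrite /gapweight !big_ord0 divr1. Qed.

Lemma gapweightS x k :
  gapweight x k.+1 = gapweight x k * (1 + s * x * q ^+ k) / (1 - q ^+ k.+1).
Proof.
rewrite /gapweight !big_ord_recr /= -exprS; field.
by rewrite prodq_neq0 andbT q_gen.
Qed.

Lemma topweight0 : topweight 0 = 1.
Proof. by rewrite /topweight !big_ord0 divr1. Qed.

Lemma topweightS k :
  topweight k.+1 = topweight k * (1 - q ^+ k.+1) / (1 - s ^+ 2 * q ^+ k).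
Proof.
rewrite /topweight !big_ord_recr /= -exprS; field.
by rewrite prods_neq0 andbT s_gen.
Qed.

(** Since q y + s q^(i+1) = q (y + s q^i), passing from y to q y shifts the product by one index,
    and s + q y is the only new factor. *)
Lemma hweight_qshift y k :
  hweight (q * y) k.+1 = hweight y k * (s + q * y) * q ^+ k / (1 - q ^+ k.+1).
Proof.
rewrite /hweight big_ord_recl big_ord_recr /= -exprS.
have -> : \prod_(i < k) (q * y + s * q ^+ bump 0 i) =
          q ^+ k * \prod_(i < k) (y + s * q ^+ i).
  rewrite -[in q ^+ k](card_ord k) -prodr_const -big_split /=.
  by apply: eq_bigr => i _; rewrite /bump /= add1n exprS; ring.
rewrite expr0; field.
by rewrite prodq_neq0 andbT q_gen.
Qed.

Lemma gapweight_qshift y k : 1 + s * y != 0 ->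
  gapweight (q * y) k = gapweight y k * (1 + s * y * q ^+ k) / (1 + s * y).
Proof.
move=> sy; rewrite /gapweight.
suff -> : \prod_(i < k) (1 - - (s * (q * y)) * q ^+ i) =
   \prod_(i < k) (1 - - (s * y) * q ^+ i) * (1 + s * y * q ^+ k) / (1 + s * y).
  by field; rewrite sy prodq_neq0.
elim: k => [|k IH]; first by rewrite !big_ord0 expr0; field.
by rewrite !big_ord_recr /= IH exprS; field.
Qed.

Lemma thinE y (v : nat) (a b : bool) (u' : nat) :
  thin y (u' + v + a) (u' + v) (u' + b) u' = thin_vertex y v a b.
Proof.
rewrite /thin addKn.
have -> : [&& u' <= u' + v, u' + v <= u' + v + a <= (u' + v).+1
  & u' <= u' + b <= u'.+1]%N by case: a b => [] []; lia.
have -> : (u' + v < u' + v + a)%N = a by case: a; lia.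
by have -> : (u' < u' + b)%N = b by case: b; lia.
Qed.

Lemma thin0 y k u k' u' :
  ~~ [&& u' <= u, u <= k <= u.+1 & u' <= k' <= u'.+1]%N ->
  thin y k u k' u' = 0.
Proof. by rewrite /thin => /negbTE ->. Qed.

Lemma RmatE x y (a b : bool) (u l k n H : nat) :
  k = (u + a)%N -> l = (n + b)%N -> k = (l + H)%N -> (n <= u)%N ->
  Rmat x y l u k n = Rvertex x y a H b.
Proof.
move=> e1 e2 e3 e4; rewrite /Rmat e3 addKn -e3 e1 e2 e4.
have -> : [&& u <= u + a <= u.+1, n <= n + b <= n.+1, n + b <= u + a & true]%N.
  by move: e1 e2 e3; case: a b => [] [] /=; lia.
have -> : (u < u + a)%N = a by case: a {e1}; lia.
by have -> : (n < n + b)%N = b by case: b {e2}; lia.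
Qed.

Lemma Rmat0 x y l u k n :
  ~~ [&& u <= k <= u.+1, n <= l <= n.+1, l <= k & n <= u]%N ->
  Rmat x y l u k n = 0.
Proof. by rewrite /Rmat => /negbTE ->. Qed.

Ltac nz := rewrite -?exprD -?exprS ?q_gen ?s_gen //=;
  repeat (apply/andP; split); rewrite ?mulrA -?exprD -?exprS -?mulrA ?q_gen ?s_gen //.

(** The Yang-Baxter equation with all outer edges fixed: in the notation of [ybe_local], u = u' + U,
    l = u' + P, k = l + H and u' = n' + h. The inner thin edge takes two values on each side. After
    the recursions for the weights, each case is a rational identity in the powers of q. For P = 0
    the term containing [(P + h).-1] is killed by its gap factor. *)
Lemma ybe_vertex x y (U P H h : nat) (a b : bool) :
  1 + s * y != 0 -> (U + a = P + H)%N ->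
  thin_vertex y U a false * (dif (gapweight x) P 0 * dif topweight (U + a) 0)
    * (dif (hweight x) h b * Rvertex x y false (h - b) b)
  + thin_vertex y U a true * (dif (gapweight x) P 1 * dif topweight (U + a) 1)
    * (dif (hweight x) h.+1 b * Rvertex x y true (h.+1 - b) b)
  = Rvertex x y a H false * thin_vertex y (P + h) false b
      * (dif (gapweight x) P 0 * topweight U) * hweight x h
    + Rvertex x y a H true * thin_vertex y (P + h).-1 true b
      * (dif (gapweight x) P 1 * topweight U) * hweight x h.
Proof.
move=> sy UP.
have q1 := q_gen 0; rewrite expr1 in q1.
case: a UP => /= UP; rewrite ?addn1 ?addn0 in UP *.
- case: P UP => [|p] UP.
    rewrite add0n in UP; subst H.
    rewrite /dif /= !subn0 !add0n !(mul0r, mulr0) !addr0.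
    case: b; last first.
      rewrite /= subn0 topweightS /thin_vertex /Rvertex.
      by field; rewrite s_gen sy.
    case: h => [|h] /=.
      rewrite mul0r mulr0 /thin_vertex /Rvertex !expr0; ring.
    rewrite subn1 /= hweightS topweightS /thin_vertex /Rvertex.
    by field; rewrite s_gen sy q_gen.
  move: UP; rewrite addSn => -[->].
  rewrite /dif /= !subn0 !subn1 /= addSn.
  case: b; last first.
    rewrite /= !subn0 /= topweightS gapweightS hweightS /thin_vertex /Rvertex.
    rewrite !exprS !exprD; field; nz.
  case: h => [|h] /=.
    rewrite ?subnn ?subn0 hweight0 topweightS gapweightS /thin_vertex /Rvertex.
    rewrite addn0 ?mul0r ?mulr0 ?add0r ?expr0 !exprS !exprD.
    field; nz.
  rewrite !subn1 /= hweightS topweightS gapweightS /thin_vertex /Rvertex.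
  rewrite addnS !exprS !exprD.
  field; nz.
- subst U; case: P => [|p].

    rewrite /dif /= !subn0 !add0n !(mul0r, mulr0) !addr0.
    case: b; last first.
      rewrite /= subn0 /thin_vertex /Rvertex.
      by field; rewrite sy.
    case: h => [|h] /=.
      rewrite mul0r mulr0 /thin_vertex /Rvertex !expr0; ring.
    rewrite subn1 /= hweightS /thin_vertex /Rvertex.
    by field; rewrite sy q_gen.
  rewrite addSn /dif /= !subn0 !subn1 /=.
  case: b; last first.
    rewrite /= !subn0 /= topweightS gapweightS hweightS /thin_vertex /Rvertex.
    rewrite addSn !exprS !exprD.
    field; nz.
  case: h => [|h] /=.
    rewrite ?subnn ?subn0 hweight0 topweightS gapweightS /thin_vertex /Rvertex.
    rewrite addn0 ?mul0r ?mulr0 ?add0r ?expr0 !exprS !exprD.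
    field; nz.
  rewrite !subn1 /= hweightS topweightS gapweightS /thin_vertex /Rvertex.
  rewrite !addSn addnS !exprS !exprD.
  field; nz.
Qed.

(** Only k' = u', u' + 1 and n = l - 1, l can contribute; the bounds on B put these values in range.
    The truncated weights make the equation hold also for parts that do not interlace. *)
Lemma ybe_local x y (B l u k l' u' n' : nat) :
  1 + s * y != 0 -> (l <= k)%N -> (l < B)%N -> (u'.+1 < B)%N ->
  \sum_(0 <= k' < B) thin y k u k' u' * (dif (gapweight x) l k' * dif topweight k k')
     * (dif (hweight x) k' l' * Rmat x y l' u' k' n')
  = \sum_(0 <= n < B) Rmat x y l u k n * thin y l n l' n'
     * (dif (gapweight x) n u' * dif topweight u u') * dif (hweight x) u' n'.
Proof.
move=> sy lk lB uB.
rewrite (big_nat_pair (u := u')) //; last first.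
  by move=> k' hk; rewrite thin0 ?mul0r //; lia.
(* If one of these inequalities fails, each term on either side contains a vanishing factor. *)
have [|] := boolP [&& u' <= u, u <= k <= u.+1, u' <= l, n' <= u' & n' <= l' <= n'.+1]%N; last first.
  move=> bad; rewrite big1 => [|n _].
    have [c1|c1] := boolP (u' <= u <= k)%N; last by rewrite !thin0 ?mul0r ?addr0 //; lia.
    have [c2|c2] := boolP (k <= u.+1)%N; last by rewrite !thin0 ?mul0r ?addr0 //; lia.
    have [c3|c3] := boolP (u' <= l)%N; last first.
      by rewrite !(dif_lt (gapweight x)) ?(mul0r, mulr0) ?addr0 //; lia.
    by rewrite !Rmat0 ?mulr0 ?addr0 //; lia.
  have [c1|c1] := boolP [&& u <= k <= u.+1 & n <= l <= n.+1]%N; last first.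
    by rewrite Rmat0 ?mul0r //; lia.
  have [c2|c2] := boolP [&& n' <= l' & l' <= n'.+1]%N; last first.
    by rewrite thin0 ?(mul0r, mulr0) //; lia.
  have [c3|c3] := boolP (n' <= u' <= u)%N; last first.
    have [c4|c4] := boolP (n' <= u')%N; last first.
      by rewrite (dif_lt (hweight x)) ?mulr0 //; lia.
    by rewrite (dif_lt topweight) ?(mulr0, mul0r) //; lia.
  by rewrite (dif_lt (gapweight x)) ?(mulr0, mul0r) //; lia.
case/and5P => u'u uk u'l n'u' l'n'.
have [a ka] : exists a : bool, k = (u + a)%N.
  by exists (u < k)%N; case: ltnP; lia.
have [b lb] : exists b : bool, l' = (n' + b)%N.
  by exists (n' < l')%N; case: ltnP; lia.
have [h uh] : exists h, u' = (n' + h)%N by exists (u' - n')%N; lia.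
have [P lP] : exists P, l = (u' + P)%N by exists (l - u')%N; lia.
have [H kH] : exists H, k = (l + H)%N by exists (k - l)%N; lia.
have [U uU] : exists U, u = (u' + U)%N by exists (u - u')%N; lia.
have UP : (U + a = P + H)%N by lia.
have E := ybe_vertex x h b sy UP.
have tE (e : bool) : thin y k u (u' + e) u' = thin_vertex y U a e.
  by rewrite ka uU thinE.
have := tE false; have := tE true; rewrite /= addn0 addn1 => -> ->.
have dE phi m : dif phi l (u' + m) = dif phi P m.
  by rewrite lP /dif leq_add2l subnDl.
have := dE (gapweight x) 0%N; have := dE (gapweight x) 1%N; rewrite addn0 addn1 => -> ->.
have dE' phi m : dif phi k (u' + m) = dif phi (U + a) m.
  by rewrite ka uU -addnA /dif leq_add2l subnDl.
have := dE' topweight 0%N; have := dE' topweight 1%N; rewrite addn0 addn1 => -> ->.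
have RE (e : bool) : (l' <= u' + e)%N ->
    Rmat x y l' u' (u' + e) n' = Rvertex x y e (h + e - b) b.
  by move=> le; rewrite (@RmatE _ _ e b _ _ _ _ (h + e - b)) //; lia.
have fRE (e : bool) : dif (hweight x) (u' + e) l' * Rmat x y l' u' (u' + e) n' =
    dif (hweight x) (h + e) b * Rvertex x y e (h + e - b) b.
  have [le|gt] := leqP l' (u' + e).
    by rewrite RE // lb uh /dif -addnA leq_add2l subnDl.
  by rewrite !dif_lt ?mul0r //; lia.
have := fRE false; have := fRE true; rewrite /= !addn0 !addn1 => -> ->.
rewrite E.
have topE : dif topweight u u' = topweight U by rewrite uU dif_add.
have fE : dif (hweight x) u' n' = hweight x h by rewrite uh dif_add.
have R0 (c : bool) n : (n + c)%N = l -> (n <= u)%N ->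
    Rmat x y l u k n = Rvertex x y a H c.
  by move=> nc nu; rewrite (@RmatE _ _ a c _ _ _ _ H).
(* The truncation of [Rmat] is harmless here: l > u forces k = l = u + 1, and then the entry is 1 -
   q^0 = 0 in any case. *)
have lnR : Rmat x y l u k l = Rvertex x y a H false.
  have [lu|lu] := leqP l u; first by rewrite (R0 false) ?addn0.
  have [-> ->] : a = true /\ H = 0%N by case: a ka {E fRE R0 UP tE dE'} => ?; split=> //; lia.
  by rewrite Rmat0 /Rvertex ?expr0 ?subrr ?mul0r //; lia.
have thinl (c : bool) v : (n' + v + c)%N = l ->
    thin y l (n' + v) l' n' = thin_vertex y v c b.
  by move=> <-; rewrite lb thinE.
have lE : dif (gapweight x) l u' = dif (gapweight x) P 0.
  by rewrite lP dif_add /dif leq0n subn0.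
case: P lP dE UP E lE => [|p] lP dE UP E lE.
  rewrite (big_nat_single (u := l)) //; last first.
    move=> n nl; have [nl'|nl'] := boolP (n.+1 == l)%N.
      by rewrite (dif_lt (gapweight x)) ?(mulr0, mul0r) //; lia.
    by rewrite Rmat0 ?mul0r //; lia.
  rewrite lnR lE topE fE (@dif_lt _ 0 1) // !(mul0r, mulr0) addr0.
  rewrite (_ : thin _ _ _ _ _ = thin_vertex y (0 + h) false b) //.
  by rewrite -(thinl false (0 + h)%N) ?addn0; [congr (thin _ _ _ _ _); lia | lia].
have lS : l = (u' + p).+1 by lia.
rewrite lS (big_nat_pair (u := u' + p)) -?lS //; last first.
  by move=> n hn; rewrite Rmat0 ?mul0r //; lia.
rewrite [RHS]addrC lnR lE topE fE; congr (_ + _).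
  rewrite (_ : thin _ _ _ _ _ = thin_vertex y (p.+1 + h) false b) //.
  by rewrite -(thinl false (p.+1 + h)%N) ?addn0; [congr (thin _ _ _ _ _); lia | lia].
rewrite (R0 true); [|lia|].
  rewrite addSn /= dif_add -[gapweight x p](dif_add _ 1) add1n.
  rewrite (_ : thin _ _ _ _ _ = thin_vertex y (p + h) true b) //.
  by rewrite -(thinl true (p + h)%N) ?addn1; [congr (thin _ _ _ _ _); lia | lia].
by lia.
Qed.

Lemma big_nat_pair_pred (B l : nat) (phi : nat -> F) :
  (l < B)%N -> (forall k, ~~ (k <= l <= k.+1)%N -> phi k = 0) ->
  \sum_(0 <= k < B) phi k = phi l + (if l is l0.+1 then phi l0 else 0).
Proof.
move=> lB phi0; case: l lB phi0 => [|l] lB phi0.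
  by rewrite (big_nat_single (u := 0)) ?addr0 // => k k0; apply: phi0; lia.
by rewrite (big_nat_pair (u := l)) // => [|k hk]; rewrite 1?addrC // phi0 //; lia.
Qed.

(** Origin of the eigenvalue: the weights of column 0 form an eigenvector of the R-matrix. *)
Lemma left_boundary_local x y (B l u n : nat) :
  1 + s * y != 0 -> (u.+1 < B)%N ->
  \sum_(0 <= k < B) thin_left y k u * dif (hweight x) k l * Rmat x y l u k n
  = (1 - x * y) / (1 + s * y) * (thin_left y l n * dif (hweight x) u n).
Proof.
move=> sy uB; rewrite (big_nat_pair (u := u)) //; last first.
  by move=> k hk; rewrite Rmat0 ?mulr0 //; lia.
rewrite /thin_left eqxx eqn_leq ltnn eqxx /=.
have [|bad] := boolP [&& n <= u & n <= l <= n.+1]%N; last first.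
  rewrite !Rmat0 ?mulr0 ?addr0; try lia.
  have [nu|nu] := boolP (n <= u)%N; last by rewrite dif_lt ?mulr0 //; lia.
  by rewrite !ifF ?(mul0r, mulr0) //; lia.
case/andP => nu ln.
have [b lb] : exists b : bool, l = (n + b)%N.
  by exists (n < l)%N; case: ltnP; lia.
have [h uh] : exists h, u = (n + h)%N by exists (u - n)%N; lia.
have fRE (e : bool) : dif (hweight x) (u + e) l * Rmat x y l u (u + e) n =
    dif (hweight x) (h + e) b * Rvertex x y e (h + e - b) b.
  have [le|gt] := leqP l (u + e).
    rewrite lb uh -addnA /dif leq_add2l subnDl (@RmatE _ _ e b _ _ _ _ (h + e - b)) //; lia.
  by rewrite !dif_lt ?mul0r //; lia.
have := fRE false; have := fRE true; rewrite /= !addn0 !addn1.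
rewrite -!mulrA => -> ->; rewrite {fRE}.
have -> : dif (hweight x) u n = hweight x h by rewrite uh dif_add.
case: b lb => lb.
  rewrite lb addn1 eqn_leq ltnn eqxx /= /dif /= subn1 /=.
  case: h uh => [|h] uh.
    by rewrite /= hweight0 /Rvertex expr0; field.
  by rewrite /= subn1 /= hweightS /Rvertex; field; nz.
rewrite lb addn0 eqxx /dif /= !subn0 hweightS /Rvertex.
by field; nz.
Qed.

(** Summing out the first part k of the middle partition leaves the weights at q y and recreates
    [thin_left] for the next pair of parts. The sum over the middle partition can therefore be
    carried out column by column. *)
Lemma fusion_local y (B l u k' l' : nat) :
  1 + s * y != 0 -> (l < B)%N ->
  \sum_(0 <= k < B) (thin_left y l k * dif (hweight y) k u)
     * (dif (gapweight y) u k' * thin y l k l' k')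
  = dif (hweight (q * y)) l u * dif (gapweight (q * y)) u l' * thin_left y l' k'.
Proof.
move=> sy lB; rewrite (big_nat_pair_pred (l := l)) //; last first.
  by move=> k hk; rewrite thin0 ?mulr0 //; lia.
have [|bad] := boolP [&& u <= l, k' <= u & k' <= l' <= k'.+1]%N; last first.
  have [ul|ul] := boolP (u <= l)%N; last first.
    rewrite !(dif_lt (hweight _)) ?(mul0r, mulr0, add0r) //; try lia.
    by case: l lB ul bad => // l lB ul bad; rewrite dif_lt ?(mul0r, mulr0) //; lia.
  have [k'u|k'u] := boolP (k' <= u)%N; last first.
    rewrite !(dif_lt (gapweight y)) ?(mul0r, mulr0, add0r) //; try lia.
    have -> : (if l is l0.+1 then thin_left y l l0 * dif (hweight y) l0 u *
       (0 * thin y l l0 l' k') else 0) = 0 by case: l {lB ul bad} => // l; rewrite !(mul0r, mulr0).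
    have [e|e] := boolP (u < l')%N.
      by rewrite (@dif_lt _ u l') // !(mul0r, mulr0).
    by rewrite /thin_left !ifF ?mulr0 ?addr0 //; lia.
  have -> : thin_left y l' k' = 0 by rewrite /thin_left !ifF //; lia.
  rewrite thin0 ?mulr0 ?add0r; last by lia.
  by case: l lB ul bad => // l lB ul bad; rewrite thin0 ?mulr0 //; lia.
case/and3P => ul k'u l'k'.
have [b lb] : exists b : bool, l' = (k' + b)%N.
  by exists (k' < l')%N; case: ltnP; lia.
have [V uV] : exists V, u = (k' + V)%N by exists (u - k')%N; lia.
have [H lH] : exists H, l = (u + H)%N by exists (l - u)%N; lia.
have thinE' (a : bool) v : (k' + v + a)%N = l ->
    thin y l (k' + v) l' k' = thin_vertex y v a b.
  by move=> <-; rewrite lb thinE.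
have tl : thin_left y l' k' = if b then - y else 1.
  by rewrite lb /thin_left; case: b {lb thinE'}; rewrite ?addn0 ?addn1 ?eqxx // ifF //; lia.
have gE : dif (gapweight (q * y)) u l' = dif (gapweight (q * y)) V b.
  by rewrite uV lb /dif leq_add2l subnDl.
rewrite tl gE [in RHS]lH !dif_add.
have -> : dif (gapweight y) u k' = gapweight y V by rewrite uV dif_add.
have -> : thin y l l l' k' = thin_vertex y (V + H) false b.
  by rewrite -(thinE' false) ?addn0; [congr (thin _ _ _ _ _); lia | lia].
have -> : dif (hweight y) l u = hweight y H by rewrite lH dif_add.
rewrite {1}/thin_left eqxx mul1r.
case: H lH => [|H] lH.
  have -> : (if l is l0.+1 then thin_left y l l0 * dif (hweight y) l0 u *
     (gapweight y V * thin y l l0 l' k') else 0) = 0.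
    by case: l {lB ul tl gE thinE'} lH => // l lH; rewrite (@dif_lt _ l) ?(mul0r, mulr0) //; lia.
  rewrite addr0 !hweight0 !mul1r addn0 /thin_vertex.
  case: b {lb thinE' tl gE}; rewrite /dif /=; last first.
    by rewrite subn0 gapweight_qshift // mulr1 mulrA.
  case: V uV => [|V] uV; first by rewrite expr0 subrr !(mul0r, mulr0).
  by rewrite subn1 /= gapweightS gapweight_qshift //; field; nz.
have lS : l = (u + H).+1 by lia.
have tlS : thin_left y (u + H).+1 (u + H) = - y.
  by rewrite /thin_left ifF ?eqxx //; lia.
rewrite lS dif_add tlS.
have -> : thin y (u + H).+1 (u + H) l' k' = thin_vertex y (V + H) true b.
  by rewrite -lS -(thinE' true) ?addn1; [congr (thin _ _ _ _ _); lia | lia].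
rewrite hweightS hweight_qshift /thin_vertex.
case: b {lb thinE' tl gE}; rewrite /dif /=; last first.
  by rewrite subn0 gapweight_qshift // addnS !exprS !exprD; field; nz.
case: V uV => [|V] uV.
  by rewrite !(mul0r, mulr0) add0n; field; nz.
rewrite subn1 /= gapweightS gapweight_qshift // addnS addSn !exprS !exprD.
by field; nz.
Qed.

(** * Rows on N columns *)

(* Partitions with at most N parts are padded with zeros to sequences of size N. *)
Fixpoint box (N B : nat) : seq (seq nat) :=
  if N is N'.+1 then [seq k :: ka | k <- index_iota 0 B, ka <- box N' B]
  else [:: [::]].

Lemma big_boxS (N B : nat) (phi : seq nat -> F) :
  \sum_(ka <- box N.+1 B) phi ka =
  \sum_(0 <= k < B) \sum_(ka <- box N B) phi (k :: ka).
Proof. by rewrite /= big_allpairs_dep. Qed.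

(** The one-row polynomial F_{la/mu}(x) written in terms of parts: the path numbers l - u, u - l'
    and l - l' are those of the left edge, of the bottom edge minus the right edge, and of the top
    edge of a column. *)
Fixpoint skew1 (x : F) (la mu : seq nat) : F :=
  match la, mu with
  | l :: la', u :: mu' =>
      dif (hweight x) l u * dif (gapweight x) u (head 0%N la') *
      dif topweight l (head 0%N la') * skew1 x la' mu'
  | [::], [::] => 1
  | _, _ => 0
  end.

(** Here [topweight] is taken on the bottom edges, which amounts to conjugating [skew1] by the
    normalisation of F*. *)
Fixpoint skew1_dual (x : F) (la mu : seq nat) : F :=
  match la, mu with
  | l :: la', u :: mu' =>
      dif (hweight x) l u * dif (gapweight x) u (head 0%N la') *
      dif topweight u (head 0%N mu') * skew1_dual x la' mu'
  | [::], [::] => 1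
  | _, _ => 0
  end.

Fixpoint thin_columns (y : F) (ka mu : seq nat) : F :=
  match ka, mu with
  | k :: ka', u :: mu' =>
      thin y k u (head 0%N ka') (head 0%N mu') * thin_columns y ka' mu'
  | [::], [::] => 1
  | _, _ => 0
  end.

Definition thin_row (y : F) (ka mu : seq nat) : F :=
  thin_left y (head 0%N ka) (head 0%N mu) * thin_columns y ka mu.

(* The condition on the last part of lambda makes the R-matrix trivial at the right
   boundary. *)
Lemma exchange_columns x y (B : nat) (la mu : seq nat) (l u k : nat) :
  1 + s * y != 0 -> size la = size mu -> last l la = 0%N -> (l <= k)%N ->
  all (fun z => z < B)%N (l :: la) -> all (fun z => z.+1 < B)%N (u :: mu) ->
  \sum_(ka <- box (size la) B)
     (dif (gapweight x) l (head 0%N ka) * dif topweight k (head 0%N ka)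
        * skew1 x ka la)
     * (thin y k u (head 0%N ka) (head 0%N mu) * thin_columns y ka mu)
  = \sum_(0 <= n < B) Rmat x y l u k n *
    \sum_(nu <- box (size la) B)
     (dif (gapweight x) n (head 0%N mu) * dif topweight u (head 0%N mu)
        * skew1 x mu nu)
     * (thin y l n (head 0%N la) (head 0%N nu) * thin_columns y la nu).
Proof.
move=> sy; elim: la mu l u k => [|l' la IH] [|u' mu] l u k //=.
  move=> _ l0 _ _ /andP[uB _]; subst l.
  have := @ybe_local x y B 0 u k 0 0 0 sy (leq0n k) (ltn_trans (ltn0Sn u) uB).
  have B1 : (1 < B)%N by lia.
  move=> /(_ B1).
  rewrite (big_nat_single (u := 0)) ?(ltn_trans _ B1) //; last first.
    move=> k' k'0; rewrite [dif (gapweight x) 0 k']dif_lt ?(mul0r, mulr0) //; lia.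
  have -> : Rmat x y 0 0 0 0 = 1.
    by rewrite (@RmatE _ _ false false _ _ _ _ 0) // /Rvertex expr0 mulr1 divff.
  have -> : dif (hweight x) 0 0 = 1 by rewrite /dif /= hweight0.
  rewrite !mulr1 => E.
  rewrite big_seq1 /= !mulr1 mulrC E; apply: eq_bigr => n _.
  by rewrite big_seq1 /= !mulr1; ring.
move=> [sz] la0 lk /and3P[lB l'B laB] /and3P[uB u'B muB].
rewrite -/(box (size la).+1 B) big_boxS.
(* [Y n'] is the remaining part of the lattice once R stands to its left. The induction hypothesis
   pulls R through these columns, and the local equation pulls it through the current one. Where l'
   > k' the induction hypothesis does not apply, but [hweight] vanishes. *)
pose Y n' := \sum_(nu <- box (size la) B)
     (dif (gapweight x) n' (head 0%N mu) * dif topweight u' (head 0%N mu)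
        * skew1 x mu nu)
     * (thin y l' n' (head 0%N la) (head 0%N nu) * thin_columns y la nu).
transitivity (\sum_(0 <= k' < B) thin y k u k' u'
     * (dif (gapweight x) l k' * dif topweight k k') * dif (hweight x) k' l' *
     \sum_(0 <= n' < B) Rmat x y l' u' k' n' * Y n').
  apply: eq_bigr => k' _.
  have [l'k'|l'k'] := leqP l' k'.
    rewrite /Y -IH //=; last 2 first.
    - by rewrite l'B.
    - by rewrite u'B.
    rewrite big_distrr /=; apply: eq_bigr => ka _.
    by ring.
  rewrite (dif_lt _ l'k') !(mulr0, mul0r); apply: big1_seq => ka _.
  by rewrite /= (dif_lt _ l'k') !(mulr0, mul0r).
transitivity (\sum_(0 <= n' < B) (\sum_(0 <= k' < B) thin y k u k' u'
     * (dif (gapweight x) l k' * dif topweight k k')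
     * (dif (hweight x) k' l' * Rmat x y l' u' k' n')) * Y n').
  under eq_bigr do rewrite big_distrr /=.
  rewrite exchange_big /=; apply: eq_bigr => n' _.
  by rewrite big_distrl /=; apply: eq_bigr => k' _; rewrite !mulrA.
transitivity (\sum_(0 <= n' < B) \sum_(0 <= n < B) Rmat x y l u k n *
     thin y l n l' n' * (dif (gapweight x) n u' * dif topweight u u') *
     dif (hweight x) u' n' * Y n').
  by apply: eq_bigr => n' _; rewrite ybe_local // big_distrl.
rewrite exchange_big /=; apply: eq_bigr => n _.
rewrite -/(box (size la).+1 B) big_boxS big_distrr /=; apply: eq_bigr => n' _.
rewrite -!mulrA; congr (_ * _); rewrite !big_distrr /=.
by apply: eq_bigr => nu _; ring.
Qed.

(** R is inserted at the right end, pulled through all columns and absorbed by column 0, which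
    produces the scalar. The stronger bound on [mu] leaves room for [ka], whose parts may be larger
    by one. *)
Lemma exchange_rows x y (B : nat) (la mu : seq nat) :
  1 + s * y != 0 -> (0 < size la)%N -> size la = size mu ->
  last 0%N la = 0%N ->
  all (fun z => z < B)%N la -> all (fun z => z.+1 < B)%N mu ->
  \sum_(ka <- box (size la) B) thin_row y ka mu * skew1 x ka la
  = (1 - x * y) / (1 + s * y) *
    \sum_(nu <- box (size la) B) skew1 x mu nu * thin_row y la nu.
Proof.
move=> sy; case: la mu => [|l la] [|u mu] //= _ [sz] la0 laB muB.
rewrite -/(box (size la).+1 B) !big_boxS.
pose Y n := \sum_(nu <- box (size la) B)
     (dif (gapweight x) n (head 0%N mu) * dif topweight u (head 0%N mu)
        * skew1 x mu nu)
     * (thin y l n (head 0%N la) (head 0%N nu) * thin_columns y la nu).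
transitivity (\sum_(0 <= k < B) (thin_left y k u * dif (hweight x) k l) *
     \sum_(0 <= n < B) Rmat x y l u k n * Y n).
  apply: eq_bigr => k _.
  have [lk|lk] := leqP l k.
    rewrite -(exchange_columns (B := B) _ sy) // big_distrr /=.
    by apply: eq_bigr => ka _; rewrite /thin_row /=; ring.
  rewrite (dif_lt _ lk) !(mulr0, mul0r); apply: big1_seq => ka _.
  by rewrite /= (dif_lt _ lk) !(mulr0, mul0r).
under eq_bigr do rewrite big_distrr /=.
rewrite exchange_big /= big_distrr /=; apply: eq_bigr => n _.
under eq_bigr do rewrite mulrA.
rewrite -big_distrl /= left_boundary_local //; last by case/andP: muB.
rewrite -!mulrA; congr (_ * _); congr (_ * _); rewrite !big_distrr /=.
by apply: eq_bigr => nu _; rewrite /thin_row /=; ring.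
Qed.

(** [thin_left] travels to the right end, where it equals 1. As [ka] lies below [la], the box loses
    no term. *)
Lemma fusion_rows y (B : nat) (la mu : seq nat) :
  1 + s * y != 0 -> size la = size mu -> all (fun z => z < B)%N la ->
  \sum_(ka <- box (size la) B) skew1_dual y ka mu * thin_row y la ka
  = skew1_dual (q * y) la mu.
Proof.
move=> sy; elim: la mu => [|l la IH] [|u mu] //=.
  by rewrite big_seq1 /thin_row /= !mulr1.
move=> [sz] /andP[lB laB].
rewrite -/(box (size la).+1 B) big_boxS exchange_big /= -IH // big_distrr /=.
apply: eq_bigr => ka _.
transitivity (dif topweight u (head 0%N mu) * skew1_dual y ka mu *
   thin_columns y la ka * \sum_(0 <= k < B) (thin_left y l k * dif (hweight y) k u)
     * (dif (gapweight y) u (head 0%N ka) * thin y l k (head 0%N la) (head 0%N ka))).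
  by rewrite big_distrr /=; apply: eq_bigr => k _; rewrite /thin_row /=; ring.
by rewrite fusion_local // /thin_row; ring.
Qed.

(** * Boxes of sequences and interlacing *)

Lemma mem_box (N B : nat) (ka : seq nat) :
  (ka \in box N B) = (size ka == N) && all (fun z => z < B)%N ka.
Proof.
elim: N ka => [|N IH] [|k ka] //=.
  by apply/negP => /allpairsP[[a b] [_ _]].
apply/allpairsP/idP => [[[a b] /= [ha hb [-> ->]]]|].
  by move: ha hb; rewrite IH mem_index_iota eqSS /= => -> /andP[-> ->].
rewrite eqSS => /and3P[sz kB kaB]; exists (k, ka); split=> //=.
  by rewrite mem_index_iota.
by rewrite IH sz.
Qed.

Lemma box_uniq (N B : nat) : uniq (box N B).
Proof.
elim: N => [//|N IH] /=; apply: allpairs_uniq => //; first exact: iota_uniq.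
by move=> [a b] [c d] _ _ /= [-> ->].
Qed.

Lemma big_box_widen (N B B' : nat) (phi : seq nat -> F) : (B <= B')%N ->
  (forall ka, size ka = N -> ~~ all (fun z => z < B)%N ka -> phi ka = 0) ->
  \sum_(ka <- box N B') phi ka = \sum_(ka <- box N B) phi ka.
Proof.
move=> BB' phi0; rewrite (bigID (fun ka => all (fun z => z < B)%N ka)) /=.
rewrite [X in _ + X]big_seq_cond [X in _ + X]big1 ?addr0; last first.
  by move=> ka /andP[]; rewrite mem_box => /andP[/eqP sz _]; exact: phi0.
rewrite -big_filter; apply: perm_big; apply: uniq_perm; rewrite ?filter_uniq ?box_uniq //.
move=> ka; rewrite mem_filter !mem_box andbC -andbA; congr (_ && _).
by apply/andP/idP => [[]//|h]; split=> //; apply: sub_all h => z zB; exact: leq_trans zB BB'.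
Qed.

Fixpoint interlaced (la mu : seq nat) : bool :=
  match la, mu with
  | l :: la', u :: mu' => [&& u <= l, head 0 la' <= u & interlaced la' mu']
  | [::], [::] => true
  | _, _ => false
  end%N.

Lemma interlaced_size la mu : interlaced la mu -> size la = size mu.
Proof. by elim: la mu => [|l la IH] [|u mu] //= /and3P[_ _ /IH ->]. Qed.

Lemma interlaced_nth la mu i : interlaced la mu ->
  (nth 0 la i.+1 <= nth 0 mu i <= nth 0 la i)%N.
Proof.
elim: la mu i => [|l la IH] [|u mu] [|i] //= /and3P[h1 h2 h3].
  by rewrite h1 nth0 h2.
exact: IH.
Qed.

Definition noninc (la : seq nat) := forall i, (nth 0 la i.+1 <= nth 0 la i)%N.

Lemma noninc_head la i : noninc la -> (nth 0 la i <= head 0 la)%N.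
Proof.
move=> h; elim: i => [|i IH]; first by rewrite nth0.
exact: leq_trans (h i) IH.
Qed.

Lemma noninc_box la B : noninc la -> (head 0 la < B)%N ->
  all (fun z => z < B)%N la.
Proof.
move=> h hB; apply/(all_nthP 0%N) => i _.
exact: leq_ltn_trans (noninc_head i h) hB.
Qed.

Lemma interlaced_noninc la mu : interlaced la mu -> noninc la /\ noninc mu.
Proof.
move=> h; split=> i; have /andP[h1 h2] := interlaced_nth i h.
  exact: leq_trans h1 h2.
by have /andP[h3 h4] := interlaced_nth i.+1 h; exact: leq_trans h4 h1.
Qed.

Lemma dif_neq0 (phi : nat -> F) a b : dif phi a b != 0 -> (b <= a)%N.
Proof. by rewrite /dif; case: leqP => //; rewrite eqxx. Qed.

Lemma skew1_interlaced x la mu : skew1 x la mu != 0 -> interlaced la mu.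
Proof.
elim: la mu => [|l la IH] [|u mu] /=; rewrite ?eqxx //.
by rewrite !mulf_eq0 !negb_or -!andbA => /and4P[/dif_neq0 -> /dif_neq0 -> _ /IH].
Qed.

Lemma skew1_dual_interlaced x la mu : skew1_dual x la mu != 0 -> interlaced la mu.
Proof.
elim: la mu => [|l la IH] [|u mu] /=; rewrite ?eqxx //.
by rewrite !mulf_eq0 !negb_or -!andbA => /and4P[/dif_neq0 -> /dif_neq0 -> _ /IH].
Qed.

(** * Polynomials as iterated row operators *)

Definition row_op (N : nat) (K : seq nat -> seq nat -> F) (phi : seq nat -> F)
    (la : seq nat) : F :=
  \sum_(mu <- box N (head 0%N la).+1) K la mu * phi mu.

(** Interlacing bounds all parts of [mu] by the first part of [la], so [row_op] is in effect a sum
    over all [mu] with N entries. *)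
Lemma row_op_box N K phi la B :
  (forall mu, K la mu != 0 -> interlaced la mu) -> (head 0 la < B)%N ->
  row_op N K phi la = \sum_(mu <- box N B) K la mu * phi mu.
Proof.
move=> Ki lB; symmetry; apply: big_box_widen => // mu sz muB.
apply/eqP; apply: contraNT muB; rewrite mulf_eq0 negb_or => /andP[/Ki lm _].
have [n1 n2] := interlaced_noninc lm; apply: noninc_box => //.
by rewrite ltnS -!nth0; case/andP: (interlaced_nth 0 lm).
Qed.

(** F_la(x 0, ..., x m.-1) by its branching rule, on partitions padded to N entries; the empty
    partition becomes N zeros. *)
Fixpoint spinP (N : nat) (x : nat -> F) (m : nat) : seq nat -> F :=
  if m is m'.+1 then row_op N (skew1 (x m')) (spinP N x m')
  else fun la => (la == nseq N 0%N)%:R.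

Fixpoint spinP_dual (N : nat) (x : nat -> F) (m : nat) : seq nat -> F :=
  if m is m'.+1 then row_op N (skew1_dual (x m')) (spinP_dual N x m')
  else fun la => (la == nseq N 0%N)%:R.

Lemma row_op_neq0 N K phi la :
  (forall mu, K la mu != 0 -> interlaced la mu) -> row_op N K phi la != 0 ->
  exists mu, [/\ interlaced la mu, size mu = N & phi mu != 0].
Proof.
move=> Ki nz; have [|h] := boolP (has (fun mu => K la mu * phi mu != 0)
    (box N (head 0%N la).+1)).
  case/hasP => mu; rewrite mem_box => /andP[/eqP sz _].
  by rewrite mulf_eq0 negb_or => /andP[/Ki ? ?]; exists mu.
move: nz; rewrite /row_op big_seq big1 ?eqxx // => mu mub.
by apply/eqP; apply: contraNT h => h; apply/hasP; exists mu.
Qed.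

Lemma spinP_noninc N x m la : spinP N x m la != 0 -> noninc la.
Proof.
case: m => [|m] /=.
  case: (la =P _) => [-> _ i|]; last by rewrite eqxx.
  by rewrite !nth_nseq !if_same.
move=> /row_op_neq0; case; first exact: skew1_interlaced.
by move=> mu [/interlaced_noninc[]].
Qed.

(** Each row creates at most one new part. For m < N the last of the N entries is therefore 0, as
    the exchange of rows requires. *)
Lemma spinP_nth N x m la i : spinP N x m la != 0 -> (m <= i)%N ->
  nth 0%N la i = 0%N.
Proof.
elim: m la i => [|m IH] la i /=.
  by case: (la =P _) => [-> _ _|]; rewrite ?eqxx // nth_nseq if_same.
move=> /row_op_neq0; case; first exact: skew1_interlaced.
move=> mu [lm _ nz]; case: i => // i; rewrite ltnS => mi.
by have /andP[] := interlaced_nth i lm; rewrite (IH _ _ nz mi) leqn0 => /eqP.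
Qed.

Lemma spinP_dual_noninc N x m la : spinP_dual N x m la != 0 -> noninc la.
Proof.
case: m => [|m] /=.
  case: (la =P _) => [-> _ i|]; last by rewrite eqxx.
  by rewrite !nth_nseq !if_same.
move=> /row_op_neq0; case; first exact: skew1_dual_interlaced.
by move=> mu [/interlaced_noninc[]].
Qed.

Lemma thin_columns_nseq y N mu : size mu = N ->
  1 + s * y != 0 ->
  thin_columns y (nseq N 0%N) mu = (mu == nseq N 0%N)%:R.
Proof.
move=> <- sy; elim: mu => [|u mu IH] //=; rewrite ?eqxx // IH eqseq_cons.
have -> : head 0%N (nseq (size mu) 0%N) = 0%N by case: (mu).
have [->|munz] := eqVneq mu; last by rewrite mulr0 andbF.
rewrite mulr1 andbT; have -> : head 0%N (nseq (size mu) 0%N) = 0%N by case: (size mu).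
case: u => [|u]; last by rewrite thin0.
by rewrite /thin /thin_vertex /= expr0 mulr1 divff.
Qed.

(** The thin row is moved through the rows of x one at a time, each contributing one factor, until
    it meets the empty partition, on which its weight is normalised to 1. *)
Lemma thin_row_eigen N x m y B mu :
  1 + s * y != 0 -> (m < N)%N -> size mu = N ->
  all (fun z => z.+1 < B)%N mu ->
  \sum_(ka <- box N B) thin_row y ka mu * spinP N x m ka
  = (\prod_(i < m) ((1 - x i * y) / (1 + s * y))) * spinP N x m mu.
Proof.
move=> sy; elim: m mu => [|m IH] mu mN szmu muB.
  rewrite big_ord0 mul1r (bigD1_seq (nseq N 0%N)) ?box_uniq //=; last first.
    rewrite mem_box size_nseq eqxx all_nseq /=.
    case: (mu) szmu muB => [<- //|u mu' _ /= /andP[uB _]].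
    by apply/orP; right; exact: ltn_trans uB.
  rewrite eqxx mulr1 big1 ?addr0 => [|ka /negbTE ->]; last by rewrite mulr0.
  rewrite /thin_row thin_columns_nseq //.
  case: eqP => [->|]; last by rewrite mulr0.
  by rewrite /thin_left eqxx mulr1.
transitivity (\sum_(la <- box N B) (\sum_(ka <- box N B)
   thin_row y ka mu * skew1 (x m) ka la) * spinP N x m la).
  under [RHS]eq_bigr do rewrite big_distrl /=.
  rewrite exchange_big /= big_seq [RHS]big_seq; apply: eq_bigr => ka.
  rewrite mem_box => /andP[/eqP sz kaB].
  rewrite (@row_op_box _ _ _ _ B); first last.
  - by case: (ka) sz kaB => [sz|k ka' _ /andP[]//]; move: mN; rewrite -sz.
  - by move=> ?; exact: skew1_interlaced.
  by rewrite big_distrr /=; apply: eq_bigr => la _; rewrite mulrA.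
transitivity ((1 - x m * y) / (1 + s * y) * \sum_(nu <- box N B)
   skew1 (x m) mu nu * \sum_(la <- box N B) thin_row y la nu * spinP N x m la).
  transitivity (\sum_(la <- box N B) ((1 - x m * y) / (1 + s * y) *
    \sum_(nu <- box N B) skew1 (x m) mu nu * thin_row y la nu) * spinP N x m la).
    rewrite big_seq [RHS]big_seq; apply: eq_bigr => la.
    rewrite mem_box => /andP[/eqP sz laB].
    have [->|nz] := eqVneq (spinP N x m la) 0; first by rewrite !mulr0.
    congr (_ * _); have := @exchange_rows (x m) y B la mu sy.
    rewrite sz szmu; apply=> //; first by apply: leq_trans mN.
    by rewrite -nth_last; apply: (spinP_nth nz); rewrite sz; lia.
  under eq_bigr do rewrite big_distrr big_distrl /=.
  rewrite exchange_big /= big_distrr /=; apply: eq_bigr => nu _.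
  rewrite !big_distrr /=; apply: eq_bigr => la _.
  by rewrite !mulrA.
rewrite big_ord_recr /= (@row_op_box _ _ _ _ B); first last.
- by case: (mu) szmu muB => [sz|u mu' _ /andP[uB _]]; [move: mN; rewrite -sz | exact: ltnW].
- by move=> ?; exact: skew1_interlaced.
set c := (1 - x m * y) / _; rewrite [\prod_(i < m) _ * c]mulrC -[RHS]mulrA.
congr (_ * _).
rewrite big_distrr /= big_seq [RHS]big_seq; apply: eq_bigr => nu.
rewrite mem_box => /andP[/eqP sz nuB].
have [->|/skew1_interlaced lm] := eqVneq (skew1 (x m) mu nu) 0.
  by rewrite !mul0r mulr0.
rewrite IH ?(ltnW mN) //; first by rewrite mulrCA.
apply/(all_nthP 0%N) => i; rewrite sz => iN.
have /andP[_ h] := interlaced_nth i lm.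
by move/(all_nthP 0%N): muB => /(_ i); rewrite szmu => /(_ iN); lia.
Qed.

Lemma row_op_fusion N y phi B la :
  1 + s * y != 0 -> size la = N -> (0 < N)%N -> all (fun z => z < B)%N la ->
  row_op N (skew1_dual (q * y)) phi la
  = \sum_(ka <- box N B) thin_row y la ka * row_op N (skew1_dual y) phi ka.
Proof.
move=> sy sz N0 laB; have hB ka : size ka = N -> all (fun z => z < B)%N ka ->
    (head 0 ka < B)%N.
  by case: ka => [sk|k ka _ /andP[]//]; move: N0; rewrite -sk.
rewrite (@row_op_box _ _ _ _ B) ?hB //; last by move=> ?; exact: skew1_dual_interlaced.
transitivity (\sum_(mu <- box N B) (\sum_(ka <- box N B)
   skew1_dual y ka mu * thin_row y la ka) * phi mu).
  rewrite big_seq [RHS]big_seq; apply: eq_bigr => mu.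
  by rewrite mem_box => /andP[/eqP szm _]; rewrite -sz fusion_rows // sz szm.
under eq_bigr do rewrite big_distrl /=.
rewrite exchange_big /= big_seq [RHS]big_seq; apply: eq_bigr => ka.
rewrite mem_box => /andP[/eqP szk kaB].
rewrite (@row_op_box _ _ _ _ B) ?hB //; last by move=> ?; exact: skew1_dual_interlaced.
by rewrite big_distrr /=; apply: eq_bigr => mu _; ring.
Qed.

(** * The dual row at y = - s, and the normalisation of F* *)

Lemma hweight_oppS k : hweight (- s) k.+1 = 0.
Proof. by rewrite /hweight big_ord_recl /= expr0 mulr1 addNr mul0r mul0r. Qed.

Lemma gapweight_opp k : gapweight (- s) k * topweight k = 1.
Proof.
rewrite /gapweight /topweight.
under eq_bigr do rewrite mulrN opprK -expr2.
by field; rewrite prodq_neq0 prods_neq0.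
Qed.

(** At - s every nonempty horizontal edge has weight 0, so [la] and [mu] coincide; the gap factor
    (s^2;q)_k / (q;q)_k then cancels [topweight]. *)
Lemma skew1_dual_opp la mu : size la = size mu -> noninc la ->
  skew1_dual (- s) la mu = (la == mu)%:R.
Proof.
elim: la mu => [|l la IH] [|u mu] //= [sz] ni; rewrite IH //; last first.
  by move=> i; have := ni i.+1.
rewrite eqseq_cons; have [<-|_] := eqVneq la mu; last by rewrite mulr0 andbF.
rewrite mulr1 andbT; have [lu|lu] := eqVneq l u.
  have hu : (head 0 la <= u)%N by have := ni 0%N; rewrite /= nth0 lu.
  by rewrite lu -mulrA /dif hu leqnn subnn hweight0 mul1r gapweight_opp.
have [ul|ul] := leqP u l; last by rewrite dif_lt ?mul0r.
rewrite {1}/dif ul; have : (u < l)%N by lia.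
by rewrite -subn_gt0; case: (l - u)%N => // k _; rewrite hweight_oppS !mul0r.
Qed.

Lemma row_op_opp N phi la : size la = N -> (phi la != 0 -> noninc la) ->
  row_op N (skew1_dual (- s)) phi la = phi la.
Proof.
move=> sz ni; rewrite /row_op.
transitivity (\sum_(mu <- box N (head 0%N la).+1) (la == mu)%:R * phi la).
  rewrite big_seq [RHS]big_seq; apply: eq_bigr => mu.
  rewrite mem_box => /andP[/eqP szm _].
  have [/skew1_dual_interlaced lm|z] := boolP (skew1_dual (- s) la mu != 0).
    have [nla _] := interlaced_noninc lm.
    rewrite skew1_dual_opp ?szm //.
    by case: eqP => [->|_]; rewrite ?mul0r.
  move: z; rewrite negbK => /eqP z.
  have [->|/ni nla] := eqVneq (phi la) 0; first by rewrite z mul0r mulr0.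
  by rewrite -skew1_dual_opp ?szm // z !mul0r.
have [->|/ni nla] := eqVneq (phi la) 0.
  by apply: big1 => mu _; rewrite mulr0.
rewrite (bigD1_seq la) ?box_uniq //=; last by rewrite mem_box sz eqxx noninc_box.
rewrite eqxx mul1r big1 ?addr0 // => mu.
by rewrite eq_sym => /negbTE ->; rewrite mul0r.
Qed.

Fixpoint top_product (la : seq nat) : F :=
  if la is l :: la' then dif topweight l (head 0%N la') * top_product la' else 1.

(** The two kernels differ only in the edges on which [topweight] is taken. Iterating this
    conjugation relates F to F*, because [top_product] is 1 on the zero sequence. *)
Lemma top_product_skew x la mu :
  skew1 x la mu * top_product mu = top_product la * skew1_dual x la mu.
Proof.
elim: la mu => [|l la IH] [|u mu] /=; rewrite ?(mul0r, mulr0, mul1r, mulr1) //.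
rewrite -[LHS]mulrA [skew1 _ _ _ * _]mulrCA IH; ring.
Qed.

Lemma spinP_top_product N x m la :
  spinP N x m la = top_product la * spinP_dual N x m la.
Proof.
elim: m la => [|m IH] la /=.
  case: eqP => [->|]; rewrite ?mulr0 // mulr1.
  elim: N => [|N IH] //=; rewrite -IH mulr1.
  by case: N {IH} => [|N]; rewrite /dif /= topweight0.
rewrite /row_op big_distrr /=; apply: eq_bigr => mu _.
by rewrite IH mulrA top_product_skew mulrA.
Qed.

End LocalWeights.

(** * Limits in the complex numbers *)

Section ComplexModulus.
Variable R : realType.
Implicit Types z : R[i].

(** The norm of R[i] takes values in R[i]; this real-valued copy gives access to the exponential, to
    real series and to linear arithmetic. *)
Definition modulus z : R := complex.Re `|z|.

Lemma modulusE z : `|z| = (modulus z)%:C%C.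
Proof. by rewrite /modulus normc_def. Qed.

Lemma modulus_ge0 z : 0 <= modulus z.
Proof. by rewrite -lecR -modulusE normr_ge0. Qed.

Lemma modulus0 : modulus 0 = 0.
Proof. by rewrite /modulus normr0. Qed.

Lemma modulus1 : modulus 1 = 1.
Proof. by rewrite /modulus normr1. Qed.

Lemma modulusN z : modulus (- z) = modulus z.
Proof. by rewrite /modulus normrN. Qed.

Lemma modulus_sub z1 z2 : modulus (z1 - z2) = modulus (z2 - z1).
Proof. by rewrite -modulusN opprB. Qed.

Lemma modulusM z1 z2 : modulus (z1 * z2) = modulus z1 * modulus z2.
Proof.
apply: (fmorph_inj (real_complex R)); rewrite rmorphM /=.
by rewrite -!modulusE normrM.
Qed.

Lemma modulusX z n : modulus (z ^+ n) = modulus z ^+ n.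
Proof.
by elim: n => [|n IH]; rewrite ?expr0 ?modulus1 // !exprS modulusM IH.
Qed.

Lemma modulusV z : modulus z^-1 = (modulus z)^-1.
Proof.
apply: (fmorph_inj (real_complex R)); rewrite fmorphV /=.
by rewrite -!modulusE normfV.
Qed.

Lemma modulusD z1 z2 : modulus (z1 + z2) <= modulus z1 + modulus z2.
Proof. by rewrite -lecR -modulusE rmorphD /= -!modulusE ler_normD. Qed.

Lemma modulusB z1 z2 : modulus (z1 - z2) <= modulus z1 + modulus z2.
Proof. by rewrite -(modulusN z2) modulusD. Qed.

Lemma modulus_dist_tri z1 z2 z3 :
  modulus (z1 - z3) <= modulus (z1 - z2) + modulus (z2 - z3).
Proof. by rewrite -[z1 - z3](subrKA z2) modulusD. Qed.

Lemma modulus_sum (I : Type) (r : seq I) (P : pred I) (phi : I -> R[i]) :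
  modulus (\sum_(i <- r | P i) phi i) <= \sum_(i <- r | P i) modulus (phi i).
Proof.
elim/big_rec2: _ => [|i a b _ h]; first by rewrite modulus0.
by apply: le_trans (modulusD _ _) _; rewrite lerD2l.
Qed.

Lemma modulus_prod (I : Type) (r : seq I) (P : pred I) (phi : I -> R[i]) :
  modulus (\prod_(i <- r | P i) phi i) = \prod_(i <- r | P i) modulus (phi i).
Proof.
elim/big_rec2: _ => [|i a b _ h]; first by rewrite modulus1.
by rewrite modulusM h.
Qed.

Lemma modulus_lt1 z : `|z| < 1 -> modulus z < 1.
Proof. by rewrite modulusE -ltcR. Qed.

Lemma modulus_ge_Re z : `|complex.Re z| <= modulus z.
Proof. by rewrite -lecR -modulusE normc_ge_Re. Qed.

Lemma modulus_real (a : R) : modulus a%:C%C = `|a|.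
Proof. by rewrite /modulus normc_def /= expr0n addr0 sqrtr_sqr. Qed.

Lemma modulus_ge_Im z : `|complex.Im z| <= modulus z.
Proof.
by rewrite /modulus normc_def /= -sqrtr_sqr ler_wsqrtr // lerDr sqr_ge0.
Qed.

Lemma complex_cvgP (u : nat -> R[i]) (l : R[i]) :
  ((u : nat -> R[i]^o) @ \oo --> (l : R[i]^o)) <->
  (forall e : R, 0 < e -> \forall n \near \oo, modulus (l - u n) < e).
Proof.
split=> [/cvgrPdist_lt ul e e0|h].
  have e0' : 0 < e%:C%C :> R[i] by rewrite ltcR.
  near=> n; rewrite -ltcR -modulusE; near: n; exact: ul.
apply/cvgrPdist_lt => e; rewrite ltcE /= => /andP[/eqP im0 re0].
near=> n; have : modulus (l - u n) < complex.Re e by near: n; exact: h.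
rewrite -ltcR -modulusE => /lt_le_trans; apply.
by rewrite lecE /= im0 eqxx lexx.
Unshelve. all: by end_near. Qed.

Lemma complex_hausdorff : hausdorff_space (R[i]^o).
Proof. exact: norm_hausdorff. Qed.

(** The real and imaginary parts are telescoping series dominated by a geometric one, so
    completeness of R suffices. *)
Lemma complex_cvg_geometric (u : nat -> R[i]) (M r : R) :
  0 <= r -> r < 1 -> (forall n, modulus (u n.+1 - u n) <= M * r ^+ n) ->
  exists l, ((u : nat -> R[i]^o) @ \oo --> (l : R[i]^o)).
Proof.
move=> r0 r1 hu.
have M0 : 0 <= M by have := hu 0%N; rewrite expr0 mulr1; apply: le_trans (modulus_ge0 _).
have geo : cvgn (series (geometric M r)).
  by apply: is_cvg_geometric_series; rewrite ger0_norm.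
have comp (f : R[i] -> R) : (forall z1 z2, f (z1 - z2) = f z1 - f z2) ->
    (forall z, `|f z| <= modulus z) -> cvgn (f \o u).
  move=> fB fle.
  have : cvgn (series (telescope (f \o u))).
    apply: normed_cvg; apply: series_le_cvg geo => n /=.
    - by rewrite normr_ge0.
    - by rewrite /geometric mulr_ge0 // exprn_ge0.
    - by rewrite /telescope /= -fB; apply: le_trans (fle _) (hu n).
  move=> c; rewrite (_ : f \o u = (fun n => (f \o u) 0%N + series (telescope (f \o u)) n)).
    by apply: is_cvgD => //; exact: is_cvg_cst.
  by apply/funext => n; rewrite -eq_sum_telescope.
have cre := comp (@complex.Re R) (@raddfB _ _ _) modulus_ge_Re.
have cim := comp (@complex.Im R) (@raddfB _ _ _) modulus_ge_Im.
exists (limn (@complex.Re R \o u) +i* limn (@complex.Im R \o u))%C.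
apply/complex_cvgP => e e0.
have e2 : 0 < e / 2 by rewrite divr_gt0.
move/cvgrPdist_lt: cre => /(_ _ e2) hre.
move/cvgrPdist_lt: cim => /(_ _ e2) him.
near=> n; rewrite [e]splitr.
set z := _ - _.
have -> : z = (complex.Re z)%:C%C + 'i%C * (complex.Im z)%:C%C by case: (z) => a b; simpc.
apply: le_lt_trans (modulusD _ _) _; apply: ltrD.
  by rewrite modulus_real /z raddfB /=; near: n; exact: hre.
have -> : modulus ('i%C * (complex.Im z)%:C%C) = `|complex.Im z|.
  rewrite modulusM modulus_real /modulus normc_def /= expr0n add0r expr1n sqrtr1.
  by rewrite mul1r.
by rewrite /z raddfB /=; near: n; exact: him.
Unshelve. all: by end_near. Qed.

Lemma complex_cvgM (u v : nat -> R[i]) (a b : R[i]) :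
  (u : nat -> R[i]^o) @ \oo --> (a : R[i]^o) ->
  (v : nat -> R[i]^o) @ \oo --> (b : R[i]^o) ->
  ((fun n => u n * v n) : nat -> R[i]^o) @ \oo --> (a * b : R[i]^o).
Proof. by move=> h1 h2; exact: (@cvgM R[i] nat \oo _ u v a b h1 h2). Qed.

Lemma complex_cvgD (u v : nat -> R[i]) (a b : R[i]) :
  (u : nat -> R[i]^o) @ \oo --> (a : R[i]^o) ->
  (v : nat -> R[i]^o) @ \oo --> (b : R[i]^o) ->
  ((fun n => u n + v n) : nat -> R[i]^o) @ \oo --> (a + b : R[i]^o).
Proof. by move=> h1 h2; exact: (@cvgD _ R[i]^o nat \oo _ u v a b h1 h2). Qed.

Lemma complex_cvgV (u : nat -> R[i]) (a : R[i]) : a != 0 ->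
  (u : nat -> R[i]^o) @ \oo --> (a : R[i]^o) ->
  ((fun n => (u n)^-1) : nat -> R[i]^o) @ \oo --> (a^-1 : R[i]^o).
Proof. by move=> a0 h; exact: (@cvgV R[i] nat \oo _ u a a0 h). Qed.

Lemma complex_cvg_cst (a : R[i]) :
  ((fun=> a) : nat -> R[i]^o) @ \oo --> (a : R[i]^o).
Proof. exact: (@cvg_cst R[i]^o a nat \oo _). Qed.

Lemma complex_cvg_unique (u : nat -> R[i]) (a b : R[i]) :
  (u : nat -> R[i]^o) @ \oo --> (a : R[i]^o) ->
  (u : nat -> R[i]^o) @ \oo --> (b : R[i]^o) -> a = b.
Proof.
move=> h1 h2.
exact: (@cvg_unique R[i]^o complex_hausdorff ((u : nat -> R[i]^o) @ \oo) _ a b h1 h2).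
Qed.

Lemma complex_cvg_sum (I : Type) (r : seq I) (u : I -> nat -> R[i])
    (a : I -> R[i]) :
  (forall i, (u i : nat -> R[i]^o) @ \oo --> (a i : R[i]^o)) ->
  ((fun n => \sum_(i <- r) u i n) : nat -> R[i]^o) @ \oo -->
  (\sum_(i <- r) a i : R[i]^o).
Proof.
move=> h; elim: r => [|i r IH].
  rewrite big_nil (_ : (fun n => _) = (fun=> 0)); first exact: complex_cvg_cst.
  by apply/funext => n; rewrite big_nil.
rewrite big_cons (_ : (fun n => _) = (fun n => u i n + \sum_(j <- r) u j n)).
  exact: (complex_cvgD (h i) IH).
by apply/funext => n; rewrite big_cons.
Qed.

Lemma complex_cvg_prod (I : Type) (r : seq I) (u : I -> nat -> R[i])
    (a : I -> R[i]) :
  (forall i, (u i : nat -> R[i]^o) @ \oo --> (a i : R[i]^o)) ->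
  ((fun n => \prod_(i <- r) u i n) : nat -> R[i]^o) @ \oo -->
  (\prod_(i <- r) a i : R[i]^o).
Proof.
move=> h; elim: r => [|i r IH].
  rewrite big_nil (_ : (fun n => _) = (fun=> 1)); first exact: complex_cvg_cst.
  by apply/funext => n; rewrite big_nil.
rewrite big_cons (_ : (fun n => _) = (fun n => u i n * \prod_(j <- r) u j n)).
  exact: (complex_cvgM (h i) IH).
by apply/funext => n; rewrite big_cons.
Qed.

End ComplexModulus.

(** * Bounds *)

Section RealEstimates.
Variable R : realType.

(** From 1 + t <= exp t. The induction needs the exact partial sum of the geometric series in the
    exponent. *)
Lemma prod_geometric_bound (c r : R) : 0 <= c -> 0 <= r -> r < 1 ->
  forall n, \prod_(i < n) (1 + c * r ^+ i) <= expR (c / (1 - r)).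
Proof.
move=> c0 r0 r1 n; have r1' : 0 < 1 - r by rewrite subr_gt0.
suff h : \prod_(i < n) (1 + c * r ^+ i) <= expR (c * (1 - r ^+ n) / (1 - r)).
  apply: le_trans h _; rewrite ler_expR; apply: ler_wpM2r.
    by rewrite invr_ge0 ltW.
  by apply: ler_piMr => //; rewrite gerBl exprn_ge0.
elim: n => [|n IH]; first by rewrite big_ord0 expr0 subrr mulr0 mul0r expR0.
rewrite big_ord_recr /=.
have -> : c * (1 - r ^+ n.+1) / (1 - r) = c * (1 - r ^+ n) / (1 - r) + c * r ^+ n.
  by rewrite exprS; field; rewrite gt_eqF.
rewrite expRD; apply: ler_pM => //.
- by apply: prodr_ge0 => i _; rewrite addr_ge0 ?mulr_ge0 ?exprn_ge0.
- by rewrite addr_ge0 ?mulr_ge0 ?exprn_ge0.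
- exact: expR_ge1Dx.
Qed.

(** With t = r / r', each term of 1 + t + ... + t^n is at least t^n, hence (n + 1) t^n (1 - t) <= 1
    - t^(n+1). *)
Lemma natmul_geometric_bound (r r' : R) : 0 <= r -> r < r' ->
  forall n, n.+1%:R * r ^+ n <= (1 - r / r')^-1 * r' ^+ n.
Proof.
move=> r0 rr' n; have r'0 : 0 < r' by apply: le_lt_trans rr'.
pose t := r / r'; have t0 : 0 <= t by rewrite divr_ge0 // ltW.
have t1 : t < 1 by rewrite ltr_pdivrMr // mul1r.
have -> : r ^+ n = t ^+ n * r' ^+ n by rewrite -exprMn divfK // gt_eqF.
rewrite mulrA; apply: ler_wpM2r; [by rewrite exprn_ge0 ?ltW | rewrite -/t].
have t1' : 0 < 1 - t by rewrite subr_gt0.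
suff h : n.+1%:R * t ^+ n * (1 - t) <= 1 - t ^+ n.+1.
  by rewrite -div1r ler_pdivlMr //; apply: le_trans h _; rewrite gerBl exprn_ge0.
elim: n => [|n IH]; first by rewrite expr0 !mul1r expr1.
rewrite -natr1 mulrDl mul1r mulrDl.
have h : t * (n.+1%:R * t ^+ n * (1 - t)) <= t * (1 - t ^+ n.+1) by rewrite ler_wpM2l.
have h2 : 0 <= (1 - t) * (1 - t ^+ n.+1).
  by rewrite mulr_ge0 ?subr_ge0 // ?exprn_ile1 // ltW.
move: h h2; rewrite !exprS; lra.
Qed.

(** Absorbs the number of sequences in a box, which is a power of its side. Each factor n + 1 costs
    moving the ratio halfway towards 1. *)
Lemma poly_geometric_bound (K : nat) (r : R) : 0 <= r -> r < 1 ->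
  exists M r', [/\ 0 <= M, 0 <= r', r' < 1 &
    forall n, n.+1%:R ^+ K * r ^+ n <= M * r' ^+ n].
Proof.
move=> r0 r1; elim: K => [|K [M [r' [M0 r'0 r'1 h]]]].
  by exists 1, r; split=> // n; rewrite expr0.
have r'' : r' < (r' + 1) / 2 by lra.
exists (M * (1 - r' / ((r' + 1) / 2))^-1), ((r' + 1) / 2); split; [|lra|lra|].
  by rewrite mulr_ge0 // invr_ge0 subr_ge0 ler_pdivrMr; lra.
move=> n; rewrite exprS -mulrA.
apply: (@le_trans _ _ (n.+1%:R * (M * r' ^+ n))); first by rewrite ler_wpM2l.
rewrite mulrCA -mulrA ler_wpM2l //; exact: natmul_geometric_bound.
Qed.

End RealEstimates.

Section Estimates.
Variables (R : realType) (q s : R[i]).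
Hypotheses (q_lt1 : `|q| < 1) (s_lt1 : `|s| < 1).

Let mq1 : modulus q < 1. Proof. exact: modulus_lt1. Qed.
Let ms1 : modulus s < 1. Proof. exact: modulus_lt1. Qed.

Lemma one_sub_neq0 (z : R[i]) : modulus z < 1 -> 1 - z != 0.
Proof.
by move=> z1; rewrite subr_eq0 eq_sym; apply: contraTneq z1 => ->; rewrite modulus1 ltxx.
Qed.

Lemma modulus_mulX_le (z : R[i]) k : modulus (z * q ^+ k) <= modulus z.
Proof.
rewrite modulusM modulusX ler_piMr ?modulus_ge0 // exprn_ile1 ?modulus_ge0 // ltW //.
Qed.

Lemma q_generic k : 1 - q ^+ k.+1 != 0.
Proof. by apply: one_sub_neq0; rewrite exprS; apply: le_lt_trans (modulus_mulX_le _ _) _. Qed.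

Lemma modulus_s2 : modulus (s ^+ 2) < 1.
Proof. by rewrite modulusX exprn_ilt1 // modulus_ge0. Qed.

Lemma s_generic k : 1 - s ^+ 2 * q ^+ k != 0.
Proof. by apply: one_sub_neq0; apply: le_lt_trans (modulus_mulX_le _ _) modulus_s2. Qed.

Lemma modulus_s_mul (y : R[i]) : modulus y <= 1 -> modulus (s * y) < 1.
Proof.
by move=> y1; rewrite modulusM; apply: le_lt_trans ms1; rewrite ler_piMr ?modulus_ge0.
Qed.

Lemma one_add_neq0 (y : R[i]) : modulus y <= 1 -> 1 + s * y != 0.
Proof.
move=> y1; rewrite -[s * y]opprK; apply: one_sub_neq0.
by rewrite modulusN modulus_s_mul.
Qed.

Lemma qpoch_bound : exists M : R, 0 <= M /\
  forall (a : R[i]) n, modulus a <= 1 -> modulus (qpoch q a n) <= M.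
Proof.
exists (expR (1 / (1 - modulus q))); split; first exact: expR_ge0.
move=> a n a1; apply: le_trans (@prod_geometric_bound R 1 (modulus q) _ _ mq1 n).
- rewrite /qpoch modulus_prod; apply: ler_prod => i _; rewrite modulus_ge0 /=.
  apply: le_trans (modulusB _ _) _; rewrite modulus1 lerD2l modulusM modulusX.
  by rewrite ler_wpM2r // exprn_ge0 ?modulus_ge0.
- exact: ler01.
- exact: modulus_ge0.
Qed.

(** With t = |q|^i, convexity gives 1 / (1 - al t) <= 1 + al / (1 - al) t on [0, 1], which brings
    the inverse factors into the form of [prod_geometric_bound]. *)
Lemma qpochV_bound (al : R) : 0 <= al -> al < 1 -> exists M : R, 0 <= M /\
  forall (a : R[i]) n, modulus a <= al -> modulus (qpoch q a n)^-1 <= M.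
Proof.
move=> al0 al1; exists (expR (al / (1 - al) / (1 - modulus q))).
split; first exact: expR_ge0.
have al1' : 0 < 1 - al by rewrite subr_gt0.
move=> a n aal.
apply: le_trans (@prod_geometric_bound R (al / (1 - al)) (modulus q) _ _ mq1 n).
- rewrite /qpoch modulusV modulus_prod -prodfV; apply: ler_prod => i _.
  rewrite invr_ge0 modulus_ge0 /=.
  set t := modulus q ^+ i; have t0 : 0 <= t by rewrite exprn_ge0 ?modulus_ge0.
  have t1 : t <= 1 by rewrite exprn_ile1 ?modulus_ge0 // ltW.
  have h1 : 1 - al * t <= modulus (1 - a * q ^+ i).
    have := modulusD (1 - a * q ^+ i) (a * q ^+ i).
    rewrite subrK modulus1 [modulus (a * _)]modulusM modulusX -/t.
    have : modulus a * t <= al * t by rewrite ler_wpM2r.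
    lra.
  have h2 : 0 < 1 - al * t by nra.
  have h3 : 0 < modulus (1 - a * q ^+ i) by apply: lt_le_trans h1.
  apply: (@le_trans _ _ (1 - al * t)^-1); first by rewrite lef_pV2 ?posrE.
  rewrite -[leLHS]mul1r ler_pdivrMr //.
  have -> : (1 + al / (1 - al) * t) * (1 - al * t) = 1 + al^+2 * t * (1 - t) / (1 - al).
    by field; rewrite gt_eqF.
  rewrite lerDl divr_ge0 ?(ltW al1') // mulr_ge0 ?subr_ge0 // mulr_ge0 //.
  by rewrite exprn_ge0.
- by rewrite divr_ge0 // ltW.
- exact: modulus_ge0.
Qed.

Lemma spin_power_bound (rho : R) : 0 < rho -> exists M : R, 0 <= M /\
  forall (x : R[i]) n, modulus x <= rho ->
    modulus (spin_power q s x n) <= M * rho ^+ n.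
Proof.
move=> rho0; exists (expR (rho^-1 / (1 - modulus q))); split; first exact: expR_ge0.
move=> x n xr.
have h := @prod_geometric_bound R rho^-1 (modulus q) _ (modulus_ge0 _) mq1 n.
apply: (@le_trans _ _ (rho ^+ n * \prod_(i < n) (1 + rho^-1 * modulus q ^+ i))).
  rewrite -[in rho ^+ n](card_ord n) -prodr_const -big_split /= /spin_power modulus_prod.
  apply: ler_prod => i _; rewrite modulus_ge0 /=.
  apply: le_trans (modulusD _ _) _; rewrite mulrDr mulr1 mulrA divff ?gt_eqF // mul1r.
  apply: lerD => //; rewrite modulusM modulusX ler_piMl ?exprn_ge0 ?modulus_ge0 //.
  exact: ltW.
by rewrite mulrC ler_wpM2r ?exprn_ge0 ?(ltW rho0) // h // invr_ge0 ltW.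
Qed.

(** The limit is nonzero because the inverses of the partial products converge as well, and the two
    limits have product 1. *)
Lemma qpoch_inf_cvg (a : R[i]) : modulus a < 1 ->
  ((qpoch q a : nat -> R[i]^o) @ \oo --> (qpoch_inf q a : R[i]^o)) /\
  qpoch_inf q a != 0.
Proof.
move=> a1.
have [M [M0 hM]] := qpoch_bound.
have [M' [M'0 hM']] := qpochV_bound (modulus_ge0 a) a1.
have nz n : qpoch q a n != 0.
  apply/prodf_neq0 => i _; apply: one_sub_neq0.
  exact: le_lt_trans (modulus_mulX_le _ _) a1.
have fac n : modulus (a * q ^+ n) <= modulus q ^+ n.
  by rewrite modulusM modulusX ler_piMl ?exprn_ge0 ?modulus_ge0 // ltW.
have [l hl] : exists l, (qpoch q a : nat -> R[i]^o) @ \oo --> (l : R[i]^o).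
  apply: (@complex_cvg_geometric R _ M (modulus q)) => // [|n]; first exact: modulus_ge0.
  rewrite {1}/qpoch big_ord_recr /= -/(qpoch q a n).
  have -> : qpoch q a n * (1 - a * q ^+ n) - qpoch q a n = - (qpoch q a n * (a * q ^+ n)) by ring.
  by rewrite modulusN modulusM ler_pM ?modulus_ge0 // hM // ltW.
have [l' hl'] : exists l', ((fun n => (qpoch q a n)^-1) : nat -> R[i]^o) @ \oo --> (l' : R[i]^o).
  apply: (@complex_cvg_geometric R _ M' (modulus q)) => // [|n]; first exact: modulus_ge0.
  have -> : (qpoch q a n.+1)^-1 - (qpoch q a n)^-1 = (qpoch q a n.+1)^-1 * (a * q ^+ n).
    have := nz n.+1; rewrite /qpoch big_ord_recr /= -/(qpoch q a n) mulf_eq0 negb_or.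
    by move=> /andP[h1 h2]; field; rewrite h1 h2.
  by rewrite modulusM ler_pM ?modulus_ge0 // hM'.
have E : qpoch_inf q a = l by exact: (cvg_lim (@complex_hausdorff R) hl).
rewrite E; split=> //; apply/eqP => l0.
have h := complex_cvgM hl hl'; rewrite l0 mul0r in h.
have e : (fun n => qpoch q a n * (qpoch q a n)^-1) = (fun=> 1 : R[i]).
  by apply/funext => n /=; rewrite divff.
rewrite e in h; have /eqP := complex_cvg_unique h (@complex_cvg_cst R 1).
by rewrite eq_sym oner_eq0.
Qed.

Lemma qpoch_inf_limit (a : R[i]) : modulus a < 1 ->
  (qpoch q a : nat -> R[i]^o) @ \oo --> (qpoch_inf q a : R[i]^o).
Proof. by case/qpoch_inf_cvg. Qed.

Lemma qpoch_inf_neq0 (a : R[i]) : modulus a < 1 -> qpoch_inf q a != 0.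
Proof. by case/qpoch_inf_cvg. Qed.

End Estimates.

(** * Geometric decay in the first part *)

Section Decay.
Variables (R : realType) (q s : R[i]).
Hypotheses (q_lt1 : `|q| < 1) (s_lt1 : `|s| < 1).

Lemma size_box (N B : nat) : size (box N B) = (B ^ N)%N.
Proof.
elim: N => [|N IH] //=.
by rewrite size_allpairs IH size_iota subn0 expnS.
Qed.

(* For noninc sequences the first part is the largest, so the part of the sum outside
   a box consists of terms with first part at least B. *)
Lemma box_tail (N : nat) (M r : R) : 0 <= M -> 0 <= r -> r < 1 ->
  exists M' r', [/\ 0 <= M', 0 <= r', r' < 1 &
    forall phi : seq nat -> R[i],
      (forall la, size la = N -> modulus (phi la) <= M * r ^+ head 0%N la) ->
      (forall la, phi la != 0 -> noninc la) ->
      forall B B', (B <= B')%N ->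
      \sum_(la <- box N B' | ~~ all (fun z => z < B)%N la) modulus (phi la)
        <= M' * r' ^+ B].
Proof.
move=> M0 r0 r1.
have [M1 [r' [M10 r'0 r'1 h1]]] := poly_geometric_bound N r0 r1.
have r'1' : 0 < 1 - r' by rewrite subr_gt0.
exists (M * M1 / (1 - r')), r'; split=> //.
  by rewrite divr_ge0 ?mulr_ge0 // ltW.
move=> phi hphi ni B B' /subnKC <-.
(* At most (b + 1)^N sequences have first part b; the tail is a geometric sum over these shells. *)
have shell b : \sum_(la <- box N b.+1 | ~~ all (fun z => z < b)%N la)
    modulus (phi la) <= M * M1 * r' ^+ b.
  apply: (@le_trans _ _ (\sum_(la <- box N b.+1) M * r ^+ b)).
    rewrite big_mkcond big_seq [leRHS]big_seq; apply: ler_sum => la.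
    rewrite mem_box => /andP[/eqP sz lab].
    case: ifPn => [lan|_]; last by rewrite mulr_ge0 // exprn_ge0.
    have [->|/ni nl] := eqVneq (phi la) 0.
      by rewrite modulus0 mulr_ge0 // exprn_ge0.
    apply: le_trans (hphi _ sz) _; apply: ler_wpM2l => //.
    apply: ler_wiXn2l; rewrite ?(ltW r1) //.
    by rewrite leqNgt; apply: contra lan; exact: noninc_box.
  rewrite big_const_seq count_predT size_box iter_addr_0 -mulr_natr natrX.
  rewrite -mulrA -(mulrA M); apply: ler_wpM2l => //.
  by rewrite mulrC; exact: h1.
suff : \sum_(la <- box N (B + (B' - B)) | ~~ all (fun z => z < B)%N la)
    modulus (phi la) <= M * M1 * (r' ^+ B - r' ^+ (B + (B' - B))) / (1 - r').
  move/le_trans; apply; rewrite -!mulrA ler_wpM2l // ler_wpM2l // mulrC.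
  by rewrite ler_wpM2l ?invr_ge0 ?(ltW r'1') // gerBl exprn_ge0.
elim: (B' - B)%N => [|d IH].
  rewrite addn0 subrr mulr0 mul0r big_seq_cond big1 // => la.
  by rewrite mem_box => /andP[/andP[_ ->]].
rewrite addnS (bigID (fun la => all (fun z => z < B + d)%N la)) /=.
have -> : M * M1 * (r' ^+ B - r' ^+ (B + d).+1) / (1 - r') =
    M * M1 * (r' ^+ B - r' ^+ (B + d)) / (1 - r') + M * M1 * r' ^+ (B + d).
  by rewrite exprS; field; rewrite gt_eqF.
apply: lerD.
  apply: le_trans IH; rewrite le_eqVlt; apply/orP; left; apply/eqP.
  rewrite big_mkcond [RHS]big_mkcond.
  rewrite (@big_box_widen _ N (B + d) (B + d).+1) //; last first.
    by move=> la _ /negbTE ->; rewrite andbF.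
  rewrite big_seq [RHS]big_seq; apply: eq_bigr => la.
  by rewrite mem_box => /andP[_ ->]; rewrite andbT.
apply: le_trans (shell _).
rewrite big_mkcond [leRHS]big_mkcond; apply: ler_sum => la _.
case: ifPn => [/andP[_ ->] //|_]; case: ifP => // _; exact: modulus_ge0.
Qed.

Lemma weight_bounds (rho : R) : 0 < rho -> rho < 1 ->
  exists c, 1 <= c /\
    [/\ forall x k, modulus x <= rho -> modulus (hweight q s x k) <= c * rho ^+ k,
        forall x k, modulus x <= rho -> modulus (gapweight q s x k) <= c &
        forall k, modulus (topweight q s k) <= c].
Proof.
move=> rho0 rho1.
have q0 := modulus_ge0 q; have mq := modulus_lt1 q_lt1.
have [M1 [M10 h1]] := spin_power_bound q_lt1 s_lt1 rho0.
have [M2 [M20 h2]] := qpoch_bound q_lt1.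
have [M3 [M30 h3]] := qpochV_bound q_lt1 q0 mq.
have [M4 [M40 h4]] := qpochV_bound q_lt1 (modulus_ge0 (s ^+ 2)) (modulus_s2 s_lt1).
exists (1 + M1 * M3 + M2 * M3 + M2 * M4); split.
  by rewrite -!addrA lerDl !addr_ge0 ?mulr_ge0.
have le1 : M1 * M3 <= 1 + M1 * M3 + M2 * M3 + M2 * M4.
  by have := mulr_ge0 M20 M30; have := mulr_ge0 M20 M40; lra.
have le2 : M2 * M3 <= 1 + M1 * M3 + M2 * M3 + M2 * M4.
  by have := mulr_ge0 M10 M30; have := mulr_ge0 M20 M40; lra.
have le3 : M2 * M4 <= 1 + M1 * M3 + M2 * M3 + M2 * M4.
  by have := mulr_ge0 M10 M30; have := mulr_ge0 M20 M30; lra.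
split=> [x k xr|x k xr|k].
- rewrite modulusM.
  apply: (@le_trans _ _ (M1 * M3 * rho ^+ k)); last first.
    by apply: ler_wpM2r => //; rewrite exprn_ge0 ?ltW.
  rewrite mulrAC; apply: ler_pM; rewrite ?modulus_ge0 //; first exact: h1.
  exact: h3.
- apply: le_trans le2; rewrite modulusM; apply: ler_pM; rewrite ?modulus_ge0 //.
    apply: h2; rewrite modulusN ltW //; apply: modulus_s_mul => //.
    exact: le_trans xr (ltW rho1).
  exact: h3.
- apply: le_trans le3; rewrite modulusM; apply: ler_pM; rewrite ?modulus_ge0 //.
    by apply: h2; exact: ltW.
  exact: h4.
Qed.

Lemma modulus_dif (phi : nat -> R[i]) c a b : 0 <= c ->
  (forall k, modulus (phi k) <= c) -> modulus (dif phi a b) <= c.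
Proof. by move=> c0 h; rewrite /dif; case: ifP; rewrite ?modulus0. Qed.

(** Only the decay along the first horizontal edge is kept. All other factors, three per column in
    total, are merely bounded. *)
Lemma skew_bound (N : nat) (rho : R) : 0 < rho -> rho < 1 ->
  exists M, 0 <= M /\ forall x la mu, modulus x <= rho -> size la = N ->
    modulus (skew1 q s x la mu) <= M * rho ^+ (head 0 la - head 0 mu)%N /\
    modulus (skew1_dual q s x la mu) <= M * rho ^+ (head 0 la - head 0 mu)%N.
Proof.
move=> rho0 rho1; have [c [c1 [h1 h2 h3]]] := weight_bounds rho0 rho1.
have c0 : 0 <= c by apply: le_trans c1.
exists ((c * c * c) ^+ N); split; first by rewrite exprn_ge0 // !mulr_ge0.
have rge n k : 0 <= (c * c * c) ^+ n * rho ^+ k.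
  by rewrite mulr_ge0 // exprn_ge0 ?mulr_ge0 // ltW.
move=> x la mu xr; elim: N la mu => [|N IH] [|l la] mu //= sz.
  by case: mu => [|u mu]; rewrite ?modulus1 ?modulus0 ?expr0 ?mulr1 //= exprn_ge0 // ltW.
case: mu => [|u mu]; first by rewrite modulus0.
have f1 : modulus (dif (hweight q s x) l u) <= c * rho ^+ (l - u).
  rewrite /dif; case: ifP => _; first exact: h1.
  by rewrite modulus0 mulr_ge0 // exprn_ge0 // ltW.
have g1 v : modulus (dif (gapweight q s x) u v) <= c.
  by apply: modulus_dif => // k; exact: h2.
have w1 a b : modulus (dif (topweight q s) a b) <= c by exact: modulus_dif.
have [i1 i2] := IH la mu (succn_inj sz).
have tl1 : rho ^+ (head 0 la - head 0 mu)%N <= 1 by rewrite exprn_ile1 // ltW.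
have ccc : 0 <= (c * c * c) ^+ N by rewrite exprn_ge0 // !mulr_ge0.
have j1 : modulus (skew1 q s x la mu) <= (c * c * c) ^+ N.
  by apply: le_trans i1 _; rewrite ler_piMr.
have j2 : modulus (skew1_dual q s x la mu) <= (c * c * c) ^+ N.
  by apply: le_trans i2 _; rewrite ler_piMr.
have -> : (c * c * c) ^+ N.+1 * rho ^+ (l - u) =
  (c * rho ^+ (l - u)) * c * c * (c * c * c) ^+ N by rewrite exprS; ring.
rewrite !modulusM; split; do 3 ?[apply: ler_pM; rewrite ?mulr_ge0 ?modulus_ge0 //].
Qed.

Definition decays (N : nat) (M r : R) (phi : seq nat -> R[i]) :=
  forall la, size la = N -> modulus (phi la) <= M * r ^+ head 0%N la.

(** For u <= l one has rho^(l-u) r^u <= t^l with t the larger of rho and r; the number (l + 1)^N of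
    terms is absorbed by a larger ratio. The constants do not depend on x in the disc of radius
    rho. *)
Lemma row_op_decays (N : nat) (rho M r : R) : 0 < rho -> rho < 1 ->
  0 <= M -> 0 <= r -> r < 1 ->
  exists M' r', [/\ 0 <= M', 0 <= r', r' < 1 &
    forall x phi, modulus x <= rho -> decays N M r phi ->
      decays N M' r' (row_op N (skew1 q s x) phi) /\
      decays N M' r' (row_op N (skew1_dual q s x) phi)].
Proof.
move=> rho0 rho1 M0 r0 r1.
have [c [c0 hc]] := skew_bound N rho0 rho1.
pose t := Num.max rho r.
have t0 : 0 <= t by rewrite le_max r0 orbT.
have t1 : t < 1 by rewrite gt_max rho1.
have [M1 [r' [M10 r'0 r'1 h1]]] := poly_geometric_bound N t0 t1.
exists (c * M * M1), r'; split=> //; first by rewrite !mulr_ge0.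
move=> x phi xr dphi.
have key K : (forall la mu, K la mu != 0 -> interlaced la mu) ->
    (forall la mu, size la = N -> modulus (K la mu) <= c * rho ^+ (head 0 la - head 0 mu)%N) ->
    decays N (c * M * M1) r' (row_op N K phi).
  move=> Ki Kb la sz; apply: le_trans (modulus_sum _ _ _) _.
  apply: (@le_trans _ _ (\sum_(mu <- box N (head 0%N la).+1) c * M * t ^+ head 0%N la)).
    rewrite big_seq [leRHS]big_seq; apply: ler_sum => mu.
    rewrite mem_box => /andP[/eqP szm _]; rewrite modulusM.
    have [->|/Ki lm] := eqVneq (K la mu) 0.
      by rewrite modulus0 mul0r mulr_ge0 ?exprn_ge0 // mulr_ge0.
    have hl : (head 0 mu <= head 0 la)%N.
      by rewrite -!nth0; case/andP: (interlaced_nth 0 lm).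
    rewrite -[in leRHS](subnK hl) exprD mulrACA; apply: ler_pM; rewrite ?modulus_ge0 //.
      apply: le_trans (Kb _ _ sz) _; apply: ler_wpM2l => //.
      by apply: lerXn2r; rewrite ?nnegrE ?(ltW rho0) // le_max lexx.
    apply: le_trans (dphi _ szm) _; apply: ler_wpM2l => //.
    by apply: lerXn2r; rewrite ?nnegrE // le_max lexx orbT.
  rewrite big_const_seq count_predT size_box iter_addr_0 -mulr_natr natrX.
  rewrite -!mulrA; do 2 (apply: ler_wpM2l => //); rewrite mulrC; exact: h1.
split; apply: key => la mu.
- exact: skew1_interlaced.
- by move=> sz; case: (hc x la mu xr sz).
- exact: skew1_dual_interlaced.
- by move=> sz; case: (hc x la mu xr sz).
Qed.

Lemma thin_row_bound (N : nat) (y : R[i]) : modulus y <= 1 ->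
  exists M, 0 <= M /\ forall la mu, size la = N ->
    modulus (thin_row q s y la mu) <= M.
Proof.
(* All four numerators of [thin_vertex] have modulus at most 2. *)
move=> y1; pose c := 2 * modulus (1 + s * y)^-1.
have c0 : 0 <= c by rewrite mulr_ge0 ?modulus_ge0.
have mq := modulus_lt1 q_lt1; have ms := modulus_lt1 s_lt1.
have ms2 := modulus_s2 s_lt1.
have two (a b : R[i]) : modulus a <= 1 -> modulus b <= 1 -> modulus (a + b) <= 2.
  by move=> ha hb; apply: le_trans (modulusD _ _) _; lra.
have mz (a : R[i]) n : modulus a <= 1 -> modulus (a * q ^+ n) <= 1.
  by move=> ha; apply: le_trans (modulus_mulX_le q_lt1 _ _) ha.
have msy : modulus (s * y) <= 1 by apply: ltW; exact: modulus_s_mul.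
have hv v a b : modulus (thin_vertex q s y v a b) <= c.
  rewrite /thin_vertex modulusM; apply: ler_wpM2r; first exact: modulus_ge0.
  case: a b => [] [].
  - by rewrite modulusN; apply: two => //; apply: mz; exact: ltW.
  - by apply: two; rewrite ?modulus1 // modulusN; apply: mz; exact: ltW.
  - rewrite modulusM modulusN; apply: (@le_trans _ _ (1 * 2)); last by rewrite mul1r.
    apply: ler_pM; rewrite ?modulus_ge0 //; apply: two; rewrite ?modulus1 // modulusN.
    by rewrite -[_ ^+ _]mul1r; apply: mz; rewrite modulus1.
  - by apply: two; rewrite ?modulus1 //; exact: mz.
have ht k u k' u' : modulus (thin q s y k u k' u') <= c.
  by rewrite /thin; case: ifP; rewrite ?modulus0.
exists (c ^+ N); split; first by rewrite exprn_ge0.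
move=> la mu sz; rewrite /thin_row modulusM.
rewrite -[c ^+ N]mul1r; apply: ler_pM; rewrite ?modulus_ge0 //.
  by rewrite /thin_left; do 2 ?[case: ifP => _]; rewrite ?modulus1 ?modulusN ?modulus0.
elim: N la mu sz => [|N IH] [|l la] [|u mu] //= sz; rewrite ?modulus1 ?modulus0 ?expr0 ?exprn_ge0 //.
rewrite modulusM exprS; apply: ler_pM; rewrite ?modulus_ge0 //; apply: IH.
exact: succn_inj.
Qed.

End Decay.

(** * Elimination of one dual variable *)

Section OneVariable.
Variables (R : realType) (q s : R[i]).
Hypotheses (q_lt1 : `|q| < 1) (s_lt1 : `|s| < 1).

Lemma geometric_small (M r e : R) : 0 <= r -> r < 1 -> 0 < e ->
  \forall n \near \oo, M * r ^+ n < e.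
Proof.
move=> r0 r1 e0.
have : geometric M r @ \oo --> (0 : R) by apply: cvg_geometric; rewrite ger0_norm.
move/cvgrPdist_lt => /(_ e e0) h; near=> n.
apply: le_lt_trans (ler_norm _) _; rewrite -normrN -[- _]add0r.
near: n; exact: h.
Unshelve. all: by end_near. Qed.

Lemma box_sum_diff (N B B' : nat) (phi : seq nat -> R[i]) : (B <= B')%N ->
  \sum_(la <- box N B') phi la - \sum_(la <- box N B) phi la =
  \sum_(la <- box N B' | ~~ all (fun z => z < B)%N la) phi la.
Proof.
move=> BB'; rewrite (bigID (fun la => all (fun z => z < B)%N la)) /= addrAC.
rewrite [X in X - _](_ : _ = \sum_(la <- box N B) phi la) ?subrr ?add0r //.
rewrite big_mkcond (@big_box_widen _ N B B') //=; last by move=> la _ /negbTE ->.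
rewrite big_seq [RHS]big_seq; apply: eq_bigr => la.
by rewrite mem_box => /andP[_ ->].
Qed.

(** The rate is chosen before [phi], hence is common to all functions with the same decay; this
    later gives uniformity in y. *)
Lemma box_sum_cvg (N : nat) (M r : R) : 0 <= M -> 0 <= r -> r < 1 ->
  exists M' r', [/\ 0 <= M', 0 <= r', r' < 1 &
    forall phi : seq nat -> R[i], decays N M r phi ->
      (forall la, phi la != 0 -> noninc la) ->
      exists l, ((fun B => \sum_(la <- box N B) phi la) : nat -> R[i]^o) @ \oo
                  --> (l : R[i]^o) /\
        forall B, modulus (l - \sum_(la <- box N B) phi la) <= M' * r' ^+ B].
Proof.
move=> M0 r0 r1; have [M' [r' [M'0 r'0 r'1 h]]] := box_tail N M0 r0 r1.
exists M', r'; split=> // phi dphi ni.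
have incr B B' : (B <= B')%N ->
    modulus (\sum_(la <- box N B') phi la - \sum_(la <- box N B) phi la) <= M' * r' ^+ B.
  by move=> BB'; rewrite box_sum_diff //; apply: le_trans (modulus_sum _ _ _) _; exact: h.
have [l hl] := @complex_cvg_geometric R (fun B => \sum_(la <- box N B) phi la)
  M' r' r'0 r'1 (fun B => incr B B.+1 (leqnSn B)).
exists l; split=> // B; apply/ler_addgt0Pr => e e0.
move/complex_cvgP: hl => /(_ e e0) hl.
suff : \forall B' \near \oo, modulus (l - \sum_(la <- box N B) phi la) <= M' * r' ^+ B + e.
  by case=> n _ /(_ n); apply => /=.
near=> B'.
apply: le_trans (modulus_dist_tri _ (\sum_(la <- box N B') phi la) _) _.
rewrite addrC; apply: lerD.
  by apply: incr; near: B'; exact: nbhs_infty_ge.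
by apply: ltW; near: B'; exact: hl.
Unshelve. all: by end_near. Qed.

Lemma skew1_dual_cvg (u : nat -> R[i]) (a : R[i]) (la mu : seq nat) :
  (u : nat -> R[i]^o) @ \oo --> (a : R[i]^o) ->
  ((fun n => skew1_dual q s (u n) la mu) : nat -> R[i]^o) @ \oo -->
  (skew1_dual q s a la mu : R[i]^o).
Proof.
move=> ua; have hc k : ((fun n => hweight q s (u n) k) : nat -> R[i]^o) @ \oo -->
    (hweight q s a k : R[i]^o).
  apply: complex_cvgM; last exact: (@complex_cvg_cst R).
  apply: (@complex_cvg_prod R _ _ (fun (r : 'I_k) n => u n + s * q ^+ r)) => r.
  exact: (complex_cvgD ua (@complex_cvg_cst R _)).
have gc k : ((fun n => gapweight q s (u n) k) : nat -> R[i]^o) @ \oo -->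
    (gapweight q s a k : R[i]^o).
  apply: complex_cvgM; last exact: (@complex_cvg_cst R).
  apply: (@complex_cvg_prod R _ _ (fun (r : 'I_k) n => 1 - - (s * u n) * q ^+ r)) => r.
  rewrite (_ : (fun n => _) = (fun n => 1 + (s * q ^+ r) * u n)); last first.
    by apply/funext => n; ring.
  rewrite (_ : 1 - - (s * a) * q ^+ r = 1 + (s * q ^+ r) * a); last by ring.
  apply: (complex_cvgD (@complex_cvg_cst R _)).
  exact: (complex_cvgM (@complex_cvg_cst R _) ua).
have dc (phi : R[i] -> nat -> R[i]) b c :
    (forall k, ((fun n => phi (u n) k) : nat -> R[i]^o) @ \oo --> (phi a k : R[i]^o)) ->
    ((fun n => dif (phi (u n)) b c) : nat -> R[i]^o) @ \oo --> (dif (phi a) b c : R[i]^o).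
  by move=> h; rewrite /dif; case: ifP => _; [exact: h | exact: (@complex_cvg_cst R)].
elim: la mu => [|l la IH] [|v mu] /=; try exact: (@complex_cvg_cst R).
apply: (complex_cvgM _ (IH mu)); apply: (complex_cvgM _ (@complex_cvg_cst R _)).
by apply: complex_cvgM; [apply: (dc (hweight q s)) | apply: (dc (gapweight q s))].
Qed.

Lemma row_op_dual_cvg N (u : nat -> R[i]) (a : R[i]) (Q : seq nat -> R[i]) la :
  (u : nat -> R[i]^o) @ \oo --> (a : R[i]^o) ->
  ((fun n => row_op N (skew1_dual q s (u n)) Q la) : nat -> R[i]^o) @ \oo -->
  (row_op N (skew1_dual q s a) Q la : R[i]^o).
Proof.
move=> ua.
apply: (@complex_cvg_sum R (seq nat) _ (fun mu n => skew1_dual q s (u n) la mu * Q mu)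
  (fun mu => skew1_dual q s a la mu * Q mu)) => mu.
have h := @skew1_dual_cvg u a la mu ua.
exact: (@complex_cvgM R _ _ _ _ h (@complex_cvg_cst R (Q mu))).
Qed.

Lemma spinP_decays N (x : nat -> R[i]) m : (forall i, modulus (x i) < 1) ->
  exists M r, [/\ 0 <= M, 0 <= r, r < 1, decays N M r (spinP q s N x m) &
    decays N M r (spinP_dual q s N x m)].
Proof.
move=> x1.
have base : decays N 1 0 (fun la => (la == nseq N 0%N)%:R : R[i]).
  move=> la sz; case: eqP => [->|_]; last by rewrite modulus0 mul1r exprn_ge0.
  by case: (N) => [|n]; rewrite /= modulus1 expr0 mulr1.
elim: m => [|m [M [r [M0 r0 r1 h1 h2]]]]; first by exists 1, 0; split.
have x0 := modulus_ge0 (x m); have xm := x1 m.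
have rho0 : 0 < (modulus (x m) + 1) / 2 by lra.
have rho1 : (modulus (x m) + 1) / 2 < 1 by lra.
have [M' [r' [M'0 r'0 r'1 h]]] := row_op_decays q_lt1 s_lt1 N rho0 rho1 M0 r0 r1.
have xr : modulus (x m) <= (modulus (x m) + 1) / 2 by lra.
exists M', r'; split=> //; first by case: (h _ _ xr h1).
by case: (h _ _ xr h2).
Qed.

Section Limit.
Variables (N m : nat) (x : nat -> R[i]) (Q : seq nat -> R[i]).
Hypotheses (mN : (m < N)%N) (x_lt1 : forall i, modulus (x i) < 1).
Variables (M r : R).
Hypotheses (M0 : 0 <= M) (r0 : 0 <= r) (r1 : r < 1) (Q_decays : decays N M r Q).
Hypothesis Q_noninc : forall la, Q la != 0 -> noninc la.

(** [Q] stands for F* in the dual variables already treated and [T y] adjoins y. [S y B] is the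
    Cauchy sum cut to a box, [E y] its limit, and [c y] the eigenvalue of the thin row. *)
Let P := spinP q s N x m.
Let T y := row_op N (skew1_dual q s y) Q.
Let S y B := \sum_(la <- box N B) P la * T y la.
Let c y := \prod_(i < m) ((1 - x i * y) / (1 + s * y)).
Let E (y : R[i]) : R[i] := limn (S y : nat -> R[i]^o).

Let T_noninc y la : T y la != 0 -> noninc la.
Proof.
move=> /row_op_neq0; case; first exact: skew1_dual_interlaced.
by move=> mu [/interlaced_noninc[]].
Qed.

Let E_uniform (rho : R) : 0 < rho -> rho < 1 ->
  exists M' r', [/\ 0 <= r', r' < 1 &
    forall y, modulus y <= rho ->
      (S y : nat -> R[i]^o) @ \oo --> (E y : R[i]^o) /\
      forall B, modulus (E y - S y B) <= M' * r' ^+ B].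
Proof.
move=> rho0 rho1.
have [M1 [t1 [M10 t10 t11 hP _]]] := spinP_decays N m x_lt1.
have [M2 [t2 [M20 t20 t21 hT]]] := row_op_decays q_lt1 s_lt1 N rho0 rho1 M0 r0 r1.
have [M' [r' [M'0 r'0 r'1 h]]] := box_sum_cvg N (mulr_ge0 M10 M20) t10 t11.
exists M', r'; split=> // y yr.
have [|la nz|l [hl hB]] := h (fun la => P la * T y la).
- move=> la sz; rewrite modulusM mulrAC; apply: ler_pM; rewrite ?modulus_ge0 //.
    exact: hP.
  apply: le_trans (proj2 (hT y Q yr Q_decays) _ sz) _.
  by rewrite ler_piMr // exprn_ile1 // ltW.
- by apply: (@T_noninc y); move: nz; rewrite mulf_eq0 negb_or => /andP[].
have -> : E y = l by apply: (cvg_lim (@complex_hausdorff R) hl).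
by [].
Qed.

Let E_cvg y : modulus y < 1 -> (S y : nat -> R[i]^o) @ \oo --> (E y : R[i]^o).
Proof.
move=> y1; have y0 := modulus_ge0 y.
(* The midpoint between |y| and 1 is a positive radius even for y = 0. *)
have rho0 : 0 < (modulus y + 1) / 2 by lra.
have rho1 : (modulus y + 1) / 2 < 1 by lra.
have [M' [r' [_ _ h]]] := E_uniform rho0 rho1.
by have [|//] := h y; lra.
Qed.

Let modulus_qX y J : modulus y < 1 -> modulus (q ^+ J * y) < 1.
Proof. by move=> y1; rewrite mulrC; apply: le_lt_trans (modulus_mulX_le q_lt1 _ _) y1. Qed.

(** Fusion rewrites [S (q * y) B] with both partitions in the box of B, while the eigenvalue
    relation for [c y * S y B] lets the upper one range over the box of B + 1. The difference
    involves [P] only outside the smaller box, against bounded thin weights, and tends to 0. *)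
Let E_qshift y : modulus y < 1 -> E (q * y) = c y * E y.
Proof.
move=> y1; have qy1 : modulus (q * y) < 1 by rewrite -[q]expr1; exact: modulus_qX.
have N0 : (0 < N)%N by apply: leq_ltn_trans mN.
have sy := one_add_neq0 s_lt1 (ltW y1).
have y0 := modulus_ge0 y.
have rho0 : 0 < (modulus y + 1) / 2 by lra.
have rho1 : (modulus y + 1) / 2 < 1 by lra.
have yrho : modulus y <= (modulus y + 1) / 2 by lra.
have [M1 [t1 [M10 t10 t11 hP _]]] := spinP_decays N m x_lt1.
have [M2 [t2 [M20 t20 t21 hT]]] := row_op_decays q_lt1 s_lt1 N rho0 rho1 M0 r0 r1.
have [M3 [t3 [M30 t30 t31 tailP]]] := box_tail N M10 t10 t11.
have [M4 [t4 [M40 t40 t41 tailT]]] := box_tail N M20 t20 t21.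
have [G [G0 hG]] := thin_row_bound q_lt1 s_lt1 N (ltW y1).
have hTy := proj2 (hT y Q yrho Q_decays).
have diff B : c y * S y B - S (q * y) B = \sum_(ka <- box N B) T y ka *
   \sum_(la <- box N B.+1 | ~~ all (fun z => z < B)%N la) P la * thin_row q s y la ka.
  have e1 : S (q * y) B = \sum_(ka <- box N B) T y ka *
      \sum_(la <- box N B) P la * thin_row q s y la ka.
    under [RHS]eq_bigr do rewrite big_distrr /=.
    rewrite exchange_big /= /S big_seq [RHS]big_seq; apply: eq_bigr => la.
    rewrite mem_box => /andP[/eqP sz laB].
    rewrite /T (@row_op_fusion _ q s (q_generic q_lt1) N y Q B) //.
    by rewrite big_distrr /=; apply: eq_bigr => ka _; ring.
  have e2 : c y * S y B = \sum_(ka <- box N B) T y ka *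
      \sum_(la <- box N B.+1) P la * thin_row q s y la ka.
    rewrite /S big_distrr /= big_seq [RHS]big_seq; apply: eq_bigr => ka.
    rewrite mem_box => /andP[/eqP sz kaB].
    have := @thin_row_eigen _ q s (q_generic q_lt1) (s_generic q_lt1 s_lt1) N x m y B.+1 ka sy mN sz kaB.
    rewrite -/(c y) -/P mulrA => <-; rewrite mulrC; congr (_ * _).
    by apply: eq_bigr => la _; rewrite mulrC.
  rewrite e1 e2 -sumrB; apply: eq_bigr => ka _; rewrite -mulrBr; congr (_ * _).
  by rewrite (@box_sum_diff N B B.+1 (fun la => P la * thin_row q s y la ka)).
have bound B : modulus (c y * S y B - S (q * y) B) <= M4 * (M3 * G) * t3 ^+ B.
  rewrite diff; apply: le_trans (modulus_sum _ _ _) _.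
  apply: (@le_trans _ _ (\sum_(ka <- box N B) modulus (T y ka) * (M3 * G * t3 ^+ B))).
    apply: ler_sum => ka _; rewrite modulusM; apply: ler_wpM2l; first exact: modulus_ge0.
    apply: le_trans (modulus_sum _ _ _) _.
    apply: (@le_trans _ _ ((\sum_(la <- box N B.+1 | ~~ all (fun z => z < B)%N la)
        modulus (P la)) * G)).
      rewrite big_distrl /= big_seq_cond [leRHS]big_seq_cond.
      apply: ler_sum => la /andP[]; rewrite mem_box => /andP[/eqP sz _] _.
      by rewrite modulusM; apply: ler_wpM2l; [exact: modulus_ge0 | exact: hG].
    rewrite mulrAC; apply: ler_wpM2r => //; apply: tailP => //.
    by move=> la; exact: spinP_noninc.
  rewrite -big_distrl /= -[leRHS]mulrA; apply: ler_wpM2r.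
    by rewrite !mulr_ge0 // exprn_ge0.
  (* As N > 0, no sequence has all entries below 0, so the tail estimate at 0 bounds the whole sum
     of |T y|. *)
  have := tailT (T y) hTy (@T_noninc y) 0%N B (leq0n B).
  rewrite expr0 mulr1; apply: le_trans; rewrite [leRHS]big_mkcond /=.
  rewrite big_seq [leRHS]big_seq; apply: ler_sum => la.
  rewrite mem_box => /andP[/eqP sz _].
  have -> : all (fun z => z < 0)%N la = false.
    by case: (la) sz => // sz; move: N0; rewrite -sz.
  by [].
have h1 := E_cvg qy1.
have h2 := complex_cvgM (@complex_cvg_cst R (c y)) (E_cvg y1).
apply: (complex_cvg_unique h1).
apply/complex_cvgP => e e0.
have e2 : 0 < e / 2 by rewrite divr_gt0.
move/complex_cvgP: h2 => /(_ _ e2) h2.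
have h3 := geometric_small (M4 * (M3 * G)) t30 t31 e2.
near=> B; rewrite [e]splitr.
apply: le_lt_trans (modulus_dist_tri _ (c y * S y B) _) _; apply: ltrD.
  by near: B; exact: h2.
apply: le_lt_trans (bound B) _; near: B; exact: h3.
Unshelve. all: by end_near. Qed.

Let E_iter y J : modulus y < 1 ->
  E (q ^+ J * y) = (\prod_(j < J) c (q ^+ j * y)) * E y.
Proof.
move=> y1; elim: J => [|J IH]; first by rewrite big_ord0 expr0 !mul1r.
rewrite exprS -mulrA E_qshift ?modulus_qX // IH big_ord_recr /=; ring.
Qed.

Let c_prod y J : \prod_(j < J) c (q ^+ j * y) =
  \prod_(i < m) (qpoch q (x i * y) J / qpoch q (- (s * y)) J).
Proof.
rewrite exchange_big /=; apply: eq_bigr => i _.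
rewrite /qpoch -prodfV -big_split /=; apply: eq_bigr => j _.
by congr (_ / _); [congr (_ - _) | rewrite mulNr opprK; congr (_ + _)]; ring.
Qed.

Let Linf y := \prod_(i < m) (qpoch_inf q (x i * y) / qpoch_inf q (- (s * y))).

Let modulus_xy i y : modulus y < 1 -> modulus (x i * y) < 1.
Proof.
move=> y1; rewrite modulusM; apply: le_lt_trans y1.
by rewrite ler_piMl ?modulus_ge0 // ltW.
Qed.

Let modulus_Nsy y : modulus y < 1 -> modulus (- (s * y)) < 1.
Proof. by move=> y1; rewrite modulusN; apply: modulus_s_mul => //; exact: ltW. Qed.

Let E_zero y : modulus y < 1 -> E 0 = Linf y * E y.
Proof.
move=> y1; have y0 := modulus_ge0 y.
have mq := modulus_lt1 q_lt1; have q0 := modulus_ge0 q.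
have u0 : ((fun J => q ^+ J * y) : nat -> R[i]^o) @ \oo --> (0 : R[i]^o).
  apply/complex_cvgP => e e0; near=> J.
  rewrite sub0r modulusN modulusM modulusX mulrC.
  by near: J; exact: geometric_small.
(* Interchange of limits: the uniform rate fixes one box for all J, and the finite sum over that box
   is continuous in y. *)
have lim1 : ((fun J => E (q ^+ J * y)) : nat -> R[i]^o) @ \oo --> (E 0 : R[i]^o).
  have rho0 : 0 < (modulus y + 1) / 2 by lra.
  have rho1 : (modulus y + 1) / 2 < 1 by lra.
  have [M' [r' [r'0 r'1 h]]] := E_uniform rho0 rho1.
  apply/complex_cvgP => e e0.
  have e3 : 0 < e / 3 by rewrite divr_gt0.
  have [B _ /(_ B (leqnn B)) hB] := geometric_small M' r'0 r'1 e3.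
  have hS : ((fun J => S (q ^+ J * y) B) : nat -> R[i]^o) @ \oo --> (S 0 B : R[i]^o).
    apply: (@complex_cvg_sum R _ _ (fun la J => P la * T (q ^+ J * y) la)) => la.
    exact: (@complex_cvgM R _ _ _ _ (@complex_cvg_cst R (P la)) (@row_op_dual_cvg N _ _ Q la u0)).
  move/complex_cvgP: hS => /(_ _ e3) hS.
  near=> J.
  have -> : e = e / 3 + (e / 3 + e / 3) by lra.
  apply: le_lt_trans (modulus_dist_tri _ (S 0 B) _) _; apply: ltrD.
    apply: le_lt_trans hB; apply: (proj2 (h _ _)); rewrite modulus0; lra.
  apply: le_lt_trans (modulus_dist_tri _ (S (q ^+ J * y) B) _) _; apply: ltrD.
    by near: J; exact: hS.
  rewrite modulus_sub; apply: le_lt_trans hB; apply: (proj2 (h _ _)).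
  rewrite mulrC; apply: le_trans (modulus_mulX_le q_lt1 _ _) _; lra.
have lim2 : ((fun J => E (q ^+ J * y)) : nat -> R[i]^o) @ \oo --> (Linf y * E y : R[i]^o).
  rewrite (_ : (fun J => _) = (fun J =>
    (\prod_(i < m) (qpoch q (x i * y) J / qpoch q (- (s * y)) J)) * E y)); last first.
    by apply/funext => J; rewrite E_iter // c_prod.
  apply: (complex_cvgM _ (@complex_cvg_cst R _)).
  apply: (@complex_cvg_prod R _ _ (fun (i : 'I_m) J => qpoch q (x i * y) J / qpoch q (- (s * y)) J)).
  move=> i; apply: (complex_cvgM (qpoch_inf_limit q_lt1 (modulus_xy i y1))).
  apply: complex_cvgV; last exact: (qpoch_inf_limit q_lt1 (modulus_Nsy y1)).
  exact: qpoch_inf_neq0 (modulus_Nsy y1).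
exact: complex_cvg_unique lim1 lim2.
Unshelve. all: by end_near. Qed.

Lemma one_variable_sum (y A : R[i]) : modulus y < 1 ->
  ((fun B => \sum_(la <- box N B) spinP q s N x m la * Q la) : nat -> R[i]^o) @ \oo
    --> (A : R[i]^o) ->
  ((fun B => \sum_(la <- box N B)
      spinP q s N x m la * row_op N (skew1_dual q s y) Q la) : nat -> R[i]^o) @ \oo
    --> (A * \prod_(i < m) (qpoch_inf q (- (s * x i)) * qpoch_inf q (- (s * y))
              / (qpoch_inf q (s ^+ 2) * qpoch_inf q (x i * y))) : R[i]^o).
Proof.
move=> y1 hA.
have ms1 : modulus (- s) < 1 by rewrite modulusN; exact: modulus_lt1.
have EA : E (- s) = A.
  apply: (complex_cvg_unique (E_cvg ms1)).
  rewrite (_ : S (- s) = (fun B => \sum_(la <- box N B) P la * Q la)) //.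
  apply/funext => B; rewrite /S big_seq [RHS]big_seq; apply: eq_bigr => la.
  rewrite mem_box => /andP[/eqP sz _]; congr (_ * _).
  rewrite /T (@row_op_opp _ q s (q_generic q_lt1) (s_generic q_lt1 s_lt1)) //.
  exact: Q_noninc.
rewrite (_ : A * _ = E y); first exact: E_cvg.
(* Of the four factors in the product, [Linf (- s)] supplies (- s x_i; q)_oo / (s^2; q)_oo, and the
   inverse of [Linf y] supplies (- s y; q)_oo / (x_i y; q)_oo. *)
have h1 := E_zero ms1; have h2 := E_zero y1; rewrite EA h2 {h2} in h1.
have nz1 := qpoch_inf_neq0 q_lt1 (modulus_Nsy y1).
have nz2 i := qpoch_inf_neq0 q_lt1 (modulus_xy i y1).
have Lnz : Linf y != 0.
  by apply/prodf_neq0 => i _; rewrite mulf_neq0 // invr_eq0.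
apply: (mulfI Lnz); rewrite h1 mulrCA mulrC; congr (_ * _).
rewrite -big_split /=; apply: eq_bigr => i _.
rewrite !mulrN opprK -expr2 [x i * s]mulrC.
have := nz2 i; have := qpoch_inf_neq0 q_lt1 (modulus_s2 s_lt1) => nz3 nz4.
by field; rewrite nz1 nz3 nz4.
Qed.

End Limit.
End OneVariable.

(** * Configurations and chains of interlacing partitions *)

Section Configurations.
Variables (R : realType) (q s : R[i]).

Lemma vertex_weightE (x : R[i]) i j k l :
  vertex_weight q s x i j k l =
  if ((i + j == k + l) && (l <= i))%N then
    hweight q s x l * gapweight q s x (i - l) * topweight q s k else 0.
Proof.
rewrite /vertex_weight; case: ifP => // _.
rewrite /hweight /gapweight /topweight -/(qpoch q q l) -/(qpoch q q k).
rewrite -/(qpoch q q (i - l)) -/(qpoch q (s ^+ 2) k).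
by rewrite -/(qpoch q (- (s * x)) (i - l)) -/(spin_power q s x l) !invfM; ring.
Qed.

Lemma vertex_weight0 (x : R[i]) : vertex_weight q s x 0 0 0 0 = 1.
Proof. by rewrite vertex_weightE /= hweight0 gapweight0 topweight0 !mulr1. Qed.

Lemma limn_eventually_cst (u : nat -> R[i]) (a : R[i]) (N : nat) :
  (forall n, (N <= n)%N -> u n = a) -> limn (u : nat -> R[i]^o) = a.
Proof.
move=> h; apply: (cvg_lim (@complex_hausdorff R)).
apply/complex_cvgP => e e0; near=> n.
by rewrite h ?subrr ?modulus0 //; near: n; exact: nbhs_infty_ge.
Unshelve. all: by end_near. Qed.

(** The [hweight] of the right edge of each vertex is moved to the next column. The factor of column
    0 serves the first column, and the last right edge is empty. *)
Lemma prod_vertex_weight (x : R[i]) (la mu : seq nat) : interlaced la mu ->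
  hweight q s x (head 0%N la - head 0%N mu)%N * \prod_(c < size la)
    vertex_weight q s x (mult mu c) (nth 0 la c - nth 0 mu c)%N (mult la c)
      (nth 0 la c.+1 - nth 0 mu c.+1)%N = skew1 q s x la mu.
Proof.
elim: la mu => [|l la IH] [|u mu] //= lm.
  by rewrite big_ord0 hweight0 mulr1.
have lmI : interlaced (l :: la) (u :: mu) by [].
have /andP[h1 h2] := interlaced_nth 0 lmI.
have /andP[h3 h4] := interlaced_nth 1 lmI.
case/and3P: lm => ul lau lm; rewrite big_ord_recl -(IH mu lm) /=.
rewrite vertex_weightE /mult /= !nth0; rewrite /= !nth0 in h1 h2 h4.
rewrite ifT; last by lia.
rewrite /dif h1 ul (leq_trans h1 ul).
rewrite (_ : (u - head 0 mu - (head 0 la - head 0 mu))%N = (u - head 0 la)%N); last by lia.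
set p := \prod_(i < _) _; ring.
Qed.

Definition hor_of (la mu : seq nat) (c : nat) : nat := (nth 0 la c - nth 0 mu c)%N.

Lemma row_weightE (x : R[i]) (la mu : seq nat) : interlaced la mu ->
  row_weight q s x (mult mu) (hor_of la mu) (mult la) = skew1 q s x la mu.
Proof.
move=> lm; rewrite /row_weight -(prod_vertex_weight x lm) -!nth0; congr (_ * _).
apply: (@limn_eventually_cst _ _ (size la)) => n /subnKC <-.
rewrite big_split_ord /= [X in _ * X]big1 ?mulr1 // => i _.
have szm := interlaced_size lm.
rewrite /mult /hor_of !(nth_default 0%N) -?szm ?vertex_weight0 //; lia.
Qed.

Lemma row_weight_neq0 (x : R[i]) bot hor top :
  row_weight q s x bot hor top != 0 ->
  forall c, ((bot c + hor c == top c + hor c.+1) && (hor c.+1 <= bot c))%N.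
Proof.
move=> nz c; apply: contraNT nz => bad; rewrite /row_weight mulf_eq0; apply/orP; right.
apply/eqP; apply: (@limn_eventually_cst _ _ c.+1) => n cn.
by rewrite (bigD1 (Ordinal cn)) //= /vertex_weight (negbTE bad) mul0r.
Qed.

Lemma nth_interlaced (la mu : seq nat) : size la = size mu ->
  (forall c, (nth 0 la c.+1 <= nth 0 mu c <= nth 0 la c)%N) -> interlaced la mu.
Proof.
elim: la mu => [|l la IH] [|u mu] //= [sz] h.
have /andP[h1 h2] := h 0%N; rewrite /= in h2; rewrite h2 -nth0 h1 /=.
by apply: IH => // c; exact: (h c.+1).
Qed.

(* Conservation of paths forces the part of mu in column c to be the part of la minus
   the horizontal edge, because both sides vanish far to the right. *)
Lemma row_shape (bot hor : nat -> nat) (la : seq nat) (K : nat) :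
  (forall c, (K <= c)%N -> hor c = 0%N) -> noninc la ->
  (forall c, (bot c + hor c == mult la c + hor c.+1) && (hor c.+1 <= bot c))%N ->
  let mu := [seq (nth 0 la c - hor c)%N | c <- iota 0 (size la)] in
  [/\ interlaced la mu, bot = mult mu & hor = hor_of la mu].
Proof.
move=> hor0 ni cons mu.
have step c : (hor c.+1 <= nth 0 la c.+1 -> hor c <= nth 0 la c)%N.
  by have /andP[/eqP e1 e2] := cons c; have := ni c; rewrite /mult in e1 *; lia.
have hle c : (hor c <= nth 0 la c)%N.
  have base d : (hor (d + K) <= nth 0 la (d + K))%N by rewrite hor0 // leq_addl.
  have [|cK] := leqP K c; first by move/hor0 ->.
  have : (hor (c + (K - c)) <= nth 0 la (c + (K - c)))%N.
    by rewrite subnKC ?(ltnW cK) //; apply: (base 0%N).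
  elim: (K - c)%N => [|d IH]; first by rewrite addn0.
  by rewrite addnS => /step.
have nmu c : nth 0%N mu c = (nth 0 la c - hor c)%N.
  rewrite /mu; have [cl|cl] := ltnP c (size la).
    by rewrite (nth_map 0) ?size_iota // nth_iota.
  by rewrite !nth_default ?size_map ?size_iota.
split.
- apply: nth_interlaced; first by rewrite size_map size_iota.
  move=> c; rewrite nmu leq_subr andbT.
  have /andP[/eqP e1 e2] := cons c; have := ni c; have := hle c; have := hle c.+1.
  by rewrite /mult in e1 *; lia.
- apply/funext => c; rewrite {1}/mult !nmu.
  have /andP[/eqP e1 e2] := cons c; have := ni c; have := hle c; have := hle c.+1.
  by rewrite /mult in e1 *; lia.
- by apply/funext => c; rewrite /hor_of nmu; have := hle c; lia.
Qed.

Definition restrict_top n (hv : configuration n.+1) : configuration n :=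
  (fun r => hv.1 (widen_ord (leqnSn n) r), fun r => hv.2 (widen_ord (leqnSn n.+1) r)).

(** The bottom edges of the new row are the top edges of [hv], so [mu] enters only through the
    horizontal edges. *)
Definition extend_top n (la mu : seq nat) (hv : configuration n) : configuration n.+1 :=
  (fun r => if unlift ord_max r is Some r' then hv.1 r' else hor_of la mu,
   fun r => if unlift ord_max r is Some r' then hv.2 r' else mult la).

Lemma widen_lift_max n (r : 'I_n) : widen_ord (leqnSn n) r = lift ord_max r.
Proof. by apply: val_inj; exact/esym/lift_max. Qed.

Lemma restrict_topK n la mu (hv : configuration n) :
  restrict_top (extend_top la mu hv) = hv.
Proof.
case: hv => h v; rewrite /restrict_top /extend_top /=; congr (_, _);
  by apply/funext => r; rewrite widen_lift_max liftK.
Qed.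

Lemma extend_topK n la mu (hv : configuration n.+1) :
  hv.1 ord_max = hor_of la mu -> hv.2 ord_max = mult la ->
  extend_top la mu (restrict_top hv) = hv.
Proof.
case: hv => h v /= e1 e2; rewrite /restrict_top /extend_top /=; congr (_, _);
  apply/funext => r; case: unliftP => [r' ->|->] //; by rewrite widen_lift_max.
Qed.

Lemma extend_top_hor n la mu (hv : configuration n) :
  (extend_top la mu hv).1 ord_max = hor_of la mu.
Proof. by rewrite /= unlift_none. Qed.

Lemma extend_top_ver n la mu (hv : configuration n) :
  (extend_top la mu hv).2 ord_max = mult la.
Proof. by rewrite /= unlift_none. Qed.

Lemma config_weightS n (x : nat -> R[i]) (hv : configuration n.+1) :
  config_weight q s (fun i : 'I_n.+1 => x i) hv =
  row_weight q s (x n) ((restrict_top hv).2 ord_max) (hv.1 ord_max) (hv.2 ord_max)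
  * config_weight q s (fun i : 'I_n => x i) (restrict_top hv).
Proof.
rewrite /config_weight big_ord_recr /= mulrC; congr (_ * _).
  congr row_weight; congr (hv.2 _); exact: val_inj.
apply: eq_bigr => i _; congr row_weight; congr (hv.2 _); exact: val_inj.
Qed.

Lemma admissible_extend n la mu mu0 (hv : configuration n) :
  admissible mu mu0 hv -> interlaced la mu ->
  admissible la mu0 (extend_top la mu hv).
Proof.
case=> [[K hK] h2 h3] lm; split.
- exists (maxn K (size la)) => r c Kc; rewrite /=; case: unliftP => [r' _|_].
    by apply: hK; apply: leq_trans Kc; rewrite leq_maxl.
  by rewrite /hor_of (nth_default 0%N (s := la)) ?sub0n //; apply: leq_trans Kc; rewrite leq_maxr.
- move=> c; rewrite /= -(h2 c) (_ : ord0 = lift ord_max ord0) ?liftK //.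
  by apply: val_inj; rewrite /= /bump.
- by move=> c; rewrite extend_top_ver.
Qed.

Lemma admissible_restrict n la mu mu0 (hv : configuration n.+1) :
  admissible la mu0 hv -> (restrict_top hv).2 ord_max = mult mu ->
  admissible mu mu0 (restrict_top hv).
Proof.
case=> [[K hK] h2 h3] e; split.
- by exists K => r c; exact: hK.
- by move=> c; rewrite /= -(h2 c); congr (hv.2 _ _); exact: val_inj.
- by move=> c; rewrite e.
Qed.

Variable N : nat.

(** A finite list of admissible configurations containing all those of nonzero weight, indexed by
    chains of interlacing sequences; it turns the finitely supported sum into a sum over a list. *)
Fixpoint configs n : seq nat -> seq (configuration n) :=
  match n with
  | 0 => fun la => if la == nseq N 0%N
                   then [:: ((fun _ _ => 0%N, fun _ _ => 0%N) : configuration 0)] else [::]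
  | n'.+1 => fun la => [seq extend_top la mu hv |
       mu <- [seq mu <- box N (head 0%N la).+1 | interlaced la mu], hv <- configs n' mu]
  end.

Lemma configs_uniq n la : uniq (configs n la).
Proof.
elim: n la => [|n IH] la /=; first by case: ifP.
apply: allpairs_uniq_dep => [|mu _|]; [by rewrite filter_uniq ?box_uniq | exact: IH |].
move=> [mu hv] [mu' hv'] /allpairsPdep[a [b [ha _ /= eab]]] /allpairsPdep[a' [b' [ha' _ /= eab']]] /= e.
have ema : mu = a by case: (congr1 (@projT1 _ _) eab).
have ema' : mu' = a' by case: (congr1 (@projT1 _ _) eab').
have ehv : hv = hv' by rewrite -(restrict_topK la mu hv) e restrict_topK.
rewrite ehv; suff -> : mu = mu' by [].
move: ha ha'; rewrite -ema -ema' !mem_filter !mem_box.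
move=> /and3P[lm /eqP sz _] /and3P[lm' /eqP sz' _].
apply: (@eq_from_nth _ 0%N); first by rewrite sz sz'.
(* The truncated differences [la] - [mu] determine [mu], because interlacing makes them exact. *)
move=> c _; have /(congr1 (@^~ c)) : hor_of la mu = hor_of la mu'.
  by rewrite -(extend_top_hor la mu hv) e extend_top_hor.
rewrite /hor_of; have /andP[_ h1] := interlaced_nth c lm.
have /andP[_ h2] := interlaced_nth c lm'; lia.
Qed.

Lemma configs_admissible n la hv : hv \in configs n la -> admissible la [::] hv.
Proof.
elim: n la hv => [|n IH] la hv /=.
  case: eqP => // ->; rewrite inE => /eqP ->; split.
  - by exists 0%N.
  - by move=> c; rewrite /mult !nth_nil.
  - by move=> c; rewrite /mult !nth_nseq !if_same.
case/allpairsPdep => mu [hv' [ha hb ->]]; apply: admissible_extend; first exact: IH.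
by move: ha; rewrite mem_filter => /andP[].
Qed.

Lemma configs_complete n (x : nat -> R[i]) la hv : size la = N -> noninc la ->
  admissible la [::] hv -> config_weight q s (fun i : 'I_n => x i) hv != 0 ->
  hv \in configs n la.
Proof.
elim: n la hv => [|n IH] la hv sz ni adm /=.
  move=> _; case: adm => _ h2 h3.
  have m0 c : mult la c = 0%N.
    by rewrite -h3 (_ : ord_max = ord0) ?h2 /mult ?nth_nil //; exact: val_inj.
  have la0 : la = nseq N 0%N.
    (* All differences of consecutive parts vanish, and the entries beyond the length are 0. *)
    have const c : nth 0%N la c = nth 0%N la 0%N.
      elim: c => // c <-; have := m0 c; have := ni c; rewrite /mult; lia.
    apply: (@eq_from_nth _ 0%N); rewrite ?size_nseq // => c _.
    by rewrite nth_nseq if_same const -(const (size la)) nth_default.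
  rewrite la0 eqxx inE; apply/eqP; case: hv h2 h3 => h v /= h2 h3; congr (_, _).
    by apply/funext => -[].
  apply/funext => r; apply/funext => c.
  by rewrite (_ : r = ord0) ?h2 /mult ?nth_nil //; apply: val_inj; case: r => -[].
rewrite config_weightS mulf_eq0 negb_or => /andP[nz1 nz2].
have top : hv.2 ord_max = mult la by apply/funext => c; case: adm => _ _ ->.
have [K hK] : exists K, forall c, (K <= c)%N -> hv.1 ord_max c = 0%N.
  by case: adm => -[K hK] _ _; exists K => c; exact: hK.
have := row_weight_neq0 nz1; rewrite top => cons.
have [lm e1 e2] := row_shape hK ni cons.
set mu := map _ _ in lm e1 e2.
apply/allpairsPdep; exists mu, (restrict_top hv); split.
- rewrite mem_filter lm mem_box -(interlaced_size lm) sz eqxx /=.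
  apply: noninc_box; first by case: (interlaced_noninc lm).
  by rewrite ltnS -!nth0; case/andP: (interlaced_nth 0 lm).
- apply: IH nz2; first by rewrite -(interlaced_size lm).
    by case: (interlaced_noninc lm).
  exact: admissible_restrict adm e1.
- by rewrite extend_topK.
Qed.

Lemma configs_sum n (x : nat -> R[i]) la :
  \sum_(hv <- configs n la) config_weight q s (fun i : 'I_n => x i) hv =
  spinP q s N x n la.
Proof.
elim: n la => [|n IH] la /=.
  case: ifP => _; last by rewrite big_nil.
  by rewrite big_seq1 /config_weight big_ord0.
rewrite big_allpairs_dep /= big_filter /row_op big_mkcond /=; apply: eq_bigr => mu _.
case: ifPn => [lm|lm]; last first.
  have [->|/skew1_interlaced h] := eqVneq (skew1 q s (x n) la mu) 0; first by rewrite mul0r.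
  by rewrite h in lm.
rewrite -IH big_distrr /= big_seq [RHS]big_seq; apply: eq_bigr => hv hvc.
rewrite config_weightS restrict_topK extend_top_hor extend_top_ver; congr (_ * _).
have -> : hv.2 ord_max = mult mu.
  by apply/funext => c; case: (configs_admissible hvc).
exact: row_weightE.
Qed.

Lemma skewF_spinP n (x : nat -> R[i]) la : size la = N -> noninc la ->
  skewF q s la [::] (fun i : 'I_n => x i) = spinP q s N x n la.
Proof.
move=> sz ni; rewrite -configs_sum /skewF (fsbigE (configs n la)).
- rewrite big_seq_cond [RHS]big_seq; apply: eq_bigl => hv.
  case hvc: (hv \in configs n la) => //=.
  by rewrite mem_set //; exact: configs_admissible.
- exact: configs_uniq.
- by move=> hv; exact: configs_admissible.
- move=> hv adm; apply: contraNeq; exact: configs_complete.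
Qed.

End Configurations.

(** * From partitions to sequences of N entries *)

Definition padded (N : nat) (la : seq nat) : seq nat := mkseq (nth 0%N la) N.

Section Padding.
Variables (R : realType) (q s : R[i]).

Lemma nth_padded N la c : (size la <= N)%N -> nth 0%N (padded N la) c = nth 0%N la c.
Proof.
move=> sz; have [cN|cN] := ltnP c N; first by rewrite nth_mkseq.
by rewrite !nth_default ?size_mkseq //; exact: leq_trans sz cN.
Qed.

Lemma sorted_noninc la : sorted geq la -> noninc la.
Proof.
move=> sl i; have [il|il] := ltnP i.+1 (size la); last by rewrite nth_default.
apply: (sorted_ltn_nth _ _ sl i i.+1); rewrite ?inE //; last exact: ltnW.
by move=> a b c /= h1 h2; exact: leq_trans h2 h1.
Qed.

Lemma padded_noninc N la : (size la <= N)%N -> noninc la -> noninc (padded N la).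
Proof. by move=> sz ni i; rewrite !nth_padded. Qed.

(** Configurations see a partition only through [mult], which padding does not change. *)
Lemma spinF_spinP N n (x : 'I_n -> R[i]) (x' : nat -> R[i]) la :
  (forall i : 'I_n, x i = x' i) -> (size la <= N)%N -> sorted geq la ->
  spinF q s la x = spinP q s N x' n (padded N la).
Proof.
move=> xx' sz sl; rewrite -skewF_spinP ?size_mkseq //; last first.
  exact: padded_noninc (sorted_noninc sl).
have -> : x = (fun i : 'I_n => x' i) by apply/funext.
rewrite /spinF /skewF; apply: eq_fsbigl; rewrite /admissible.
have -> : mult (padded N la) = mult la by apply/funext => c; rewrite /mult !nth_padded.
by [].
Qed.

Lemma top_product_prod la : noninc la ->
  top_product q s la = \prod_(i < size la) topweight q s (mult la i).
Proof.
elim: la => [|l la IH] ni; first by rewrite big_ord0.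
rewrite big_ord_recl /= IH; last by move=> i; exact: (ni i.+1).
by rewrite /dif /mult /= -nth0 (ni 0%N).
Qed.

Hypotheses (q_lt1 : `|q| < 1) (s_lt1 : `|s| < 1).

Lemma spinF_dual_spinP N n (y : 'I_n -> R[i]) (y' : nat -> R[i]) la :
  (forall i : 'I_n, y i = y' i) -> (size la <= N)%N -> sorted geq la ->
  spinF_dual q s la y = spinP_dual q s N y' n (padded N la).
Proof.
move=> yy' sz sl; rewrite /spinF_dual (spinF_spinP yy' sz sl) spinP_top_product mulrA.
rewrite top_product_prod; last exact: padded_noninc (sorted_noninc sl).
have -> : \prod_(i < size (padded N la)) topweight q s (mult (padded N la) i)
    = \prod_(i < size la) topweight q s (mult la i).
  rewrite size_mkseq -(subnKC sz) big_split_ord /= [X in _ * X]big1 ?mulr1.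
    by apply: eq_bigr => i _; rewrite /mult !nth_padded // subnKC.
  move=> i _; rewrite /mult !nth_padded ?subnKC // !nth_default ?topweight0 //; lia.
rewrite -big_split /= big1 ?mul1r // => i _.
rewrite /topweight -/(qpoch q q _) -/(qpoch q (s ^+ 2) _).
have := prodq_neq0 (q_generic q_lt1) (mult la i); rewrite -/(qpoch q q _) => h1.
have := prods_neq0 (s_generic q_lt1 s_lt1) (mult la i); rewrite -/(qpoch q (s ^+ 2) _) => h2.
by field; rewrite h1 h2.
Qed.

Lemma spinF_eq0 n (x : 'I_n -> R[i]) la : is_partition la -> (n < size la)%N ->
  spinF q s la x = 0.
Proof.
case/andP => sl la0 nl.
pose x' k := if insub k is Some i then x i else 0.
have xx' i : x i = x' i by rewrite /x' valK.
rewrite (spinF_spinP xx' (leqnn _) sl); apply/eqP; apply: contraT => nz.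
have := spinP_nth nz (leqnn n); rewrite nth_padded // => e.
by move: la0; rewrite -e mem_nth.
Qed.

End Padding.

(** * The Cauchy sum over boxes *)

Section Summation.
Variables (R : realType) (q s : R[i]).
Hypotheses (q_lt1 : `|q| < 1) (s_lt1 : `|s| < 1).

Lemma skew1_nseq (x : R[i]) N : skew1 q s x (nseq N 0%N) (nseq N 0%N) = 1.
Proof.
elim: N => [|N IH] //=; rewrite IH.
have -> : head 0%N (nseq N 0%N) = 0%N by case: N {IH}.
by rewrite /dif /= hweight0 gapweight0 topweight0 !mulr1.
Qed.

Lemma box1 N : box N 1 = [:: nseq N 0%N].
Proof. by elim: N => [|N IH] //=; rewrite IH. Qed.

Lemma spinP_nseq N (x : nat -> R[i]) m : spinP q s N x m (nseq N 0%N) = 1.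
Proof.
elim: m => [|m IH] /=; first by rewrite eqxx.
rewrite /row_op; have -> : head 0%N (nseq N 0%N) = 0%N by case: (N).
by rewrite box1 big_seq1 IH skew1_nseq mulr1.
Qed.

(** Induction on the number of dual variables. With none, F* is the indicator of the empty
    partition, at which F equals 1. *)
Lemma spinP_sum_cvg N m n (x y : nat -> R[i]) : (m < N)%N ->
  (forall i, modulus (x i) < 1) -> (forall j, modulus (y j) < 1) ->
  ((fun B => \sum_(la <- box N B) spinP q s N x m la * spinP_dual q s N y n la)
     : nat -> R[i]^o) @ \oo -->
  (\prod_(j < n) \prod_(i < m)
     (qpoch_inf q (- (s * x i)) * qpoch_inf q (- (s * y j))
        / (qpoch_inf q (s ^+ 2) * qpoch_inf q (x i * y j))) : R[i]^o).
Proof.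
move=> mN x1 y1; elim: n => [|n IH].
  rewrite big_ord0; apply/complex_cvgP => e e0; near=> B.
  have B1 : (0 < B)%N by near: B; exact: nbhs_infty_ge.
  rewrite (bigD1_seq (nseq N 0%N)) ?box_uniq //=; last first.
    by rewrite mem_box size_nseq eqxx all_nseq B1 orbT.
  rewrite spinP_nseq eqxx mulr1 big1 ?addr0 ?subrr ?modulus0 //.
  by move=> la /negbTE ->; rewrite mulr0.
rewrite big_ord_recr /=.
have [M [r [M0 r0 r1 _ hd]]] := spinP_decays q_lt1 s_lt1 N n y1.
apply: (one_variable_sum q_lt1 s_lt1 mN x1 M0 r0 r1 hd _ (y1 n) IH).
by move=> la; exact: spinP_dual_noninc.
Unshelve. all: by end_near. Qed.

End Summation.

(** * Summation over all partitions *)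

Definition unpadded (la : seq nat) : seq nat := [seq z <- la | z != 0%N].

Lemma nth_unpadded la c : noninc la -> nth 0%N (unpadded la) c = nth 0%N la c.
Proof.
elim: la c => [|l la IH] c ni //.
have ni' : noninc la by move=> i; exact: (ni i.+1).
rewrite /unpadded /=; case: (eqVneq l 0%N) => [l0|_] /=; last first.
  by case: c => //= c; exact: IH.
rewrite -/(unpadded la) IH //.
have := noninc_head c ni; have := noninc_head c.+1 ni; rewrite /= l0.
by rewrite !leqn0 => /eqP -> /eqP ->.
Qed.

Lemma noninc_sorted la : noninc la -> sorted geq la.
Proof. by move=> ni; apply/(sortedP 0%N) => i _; exact: ni. Qed.

Lemma unpadded_partition la : noninc la -> is_partition (unpadded la).
Proof.
move=> ni; rewrite /is_partition mem_filter /= andbT; apply: sorted_filter.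
  by move=> a b c /= h1 h2; exact: leq_trans h2 h1.
exact: noninc_sorted.
Qed.

Lemma unpaddedK N la : size la = N -> noninc la -> padded N (unpadded la) = la.
Proof.
move=> sz ni; apply: (@eq_from_nth _ 0%N); rewrite size_mkseq // => c cN.
by rewrite nth_mkseq // nth_unpadded.
Qed.

(** The entries agree everywhere, and the absence of zero parts makes the lengths agree. *)
Lemma padded_inj N la mu : is_partition la -> is_partition mu ->
  (size la <= N)%N -> (size mu <= N)%N -> padded N la = padded N mu -> la = mu.
Proof.
move=> /andP[_ la0] /andP[_ mu0] szl szm e.
have en c : nth 0%N la c = nth 0%N mu c.
  by rewrite -(nth_padded c szl) e nth_padded.
have le (a b : seq nat) : 0%N \notin b -> (forall c, nth 0%N a c = nth 0%N b c) ->
    (size b <= size a)%N.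
  move=> b0 ab; rewrite leqNgt; apply: contra b0 => sab.
  by rewrite -(nth_default 0%N (leqnn (size a))) ab mem_nth.
apply: (@eq_from_nth _ 0%N) => //; apply/eqP; rewrite eqn_leq.
by rewrite (le mu la) // (le la mu).
Qed.

Section PartitionSum.
Variables (R : realType) (N : nat) (phi : seq nat -> R[i]).

(** A finite set of partitions containing those of a box differs from the box sum only by terms
    outside the box, whose total is bounded by the tail whatever the set is. *)
Lemma partition_sum_cvg (f : partition_type -> R[i]) (L : R[i]) (M r : R) :
  0 <= M -> 0 <= r -> r < 1 -> decays N M r phi ->
  (forall la, phi la != 0 -> noninc la) ->
  (forall p : partition_type, f p =
     if (size (val p) <= N)%N then phi (padded N (val p)) else 0) ->
  ((fun B => \sum_(la <- box N B) phi la) : nat -> R[i]^o) @ \oo --> (L : R[i]^o) ->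
  partial_sum (f : partition_type -> R[i]^o) @ totally --> (L : R[i]^o).
Proof.
move=> M0 r0 r1 dphi ni fE hL.
have [M' [r' [M'0 r'0 r'1 tail]]] := box_tail N M0 r0 r1.
have FF : Filter (@totally partition_type) by exact: totally_filter.
apply/cvgrPdist_lt => e; rewrite ltcE /= => /andP[/eqP im0 re0].
pose e' := complex.Re e.
have e2 : 0 < e' / 2 by rewrite divr_gt0.
have [B0 _ hB0] := geometric_small M' r'0 r'1 e2.
move/complex_cvgP: hL => /(_ _ e2) [B1 _ hB1].
pose B := maxn B0 B1.
have tailB : M' * r' ^+ B < e' / 2 by apply: hB0; rewrite /= leq_maxl.
have limB : modulus (L - \sum_(la <- box N B) phi la) < e' / 2.
  by apply: hB1; rewrite /= leq_maxr.
(* Sequences that do not become partitions are dropped; they are not nonincreasing, so [phi]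
   vanishes on them. *)
pose small : seq partition_type := pmap insub [seq unpadded la | la <- box N B].
exists (seq_fset tt small) => // A /= sA.
suff h : modulus (\sum_(la <- box N B) phi la - partial_sum f A) <= M' * r' ^+ B.
  have : modulus (L - partial_sum f A) < e'.
    apply: le_lt_trans (modulus_dist_tri _ (\sum_(la <- box N B) phi la) _) _.
    by rewrite [e']splitr; apply: ltrD => //; exact: le_lt_trans tailB.
  rewrite -ltcR -modulusE => /lt_le_trans; apply.
  by rewrite lecE /= im0 eqxx lexx.
pose pads := [seq padded N (val p) | p <- A & (size (val p) <= N)%N].
have sumE : partial_sum f A = \sum_(la <- pads) phi la.
  rewrite /partial_sum -(big_seq_fsetE _ A xpredT f) /=.
  rewrite big_map big_filter [RHS]big_mkcond; apply: eq_bigr => p _; exact: fE.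
have pads_uniq : uniq pads.
  rewrite map_inj_in_uniq ?filter_uniq ?fset_uniq // => p p'.
  rewrite !mem_filter => /andP[h1 _] /andP[h2 _] /padded_inj e1.
  by apply: val_inj; apply: e1 => //; exact: valP.
have pads_size la : la \in pads -> size la = N.
  by case/mapP => p _ ->; rewrite size_mkseq.
(* [B'] depends on [A], but the tail estimate does not depend on [B']. *)
pose B' := maxn B (\max_(la <- pads) \max_(z <- la) z).+1.
have pads_box la : la \in pads -> la \in box N B'.
  move=> lap; rewrite mem_box pads_size // eqxx /=; apply/allP => z zla.
  rewrite leq_max ltnS; apply/orP; right.
  apply: (@leq_trans (\max_(z <- la) z)); first exact: (@leq_bigmax_seq _ la xpredT id).
  exact: (@leq_bigmax_seq _ pads xpredT (fun la => \max_(z <- la) z)).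
have in_pads la : la \in box N B -> phi la != 0 -> la \in pads.
  move=> lab /ni nla.
  have sz : size la = N by move: lab; rewrite mem_box => /andP[/eqP].
  pose p : partition_type := exist _ (unpadded la) (unpadded_partition nla).
  have pA : p \in A.
    apply: (fsubsetP sA); have : p \in small by rewrite mem_pmap_sub /= map_f.
    by rewrite -(seq_fsetE tt).
  apply/mapP; exists p; last by rewrite /= unpaddedK.
  by rewrite mem_filter pA andbT /= size_filter -[X in (_ <= X)%N]sz count_size.
have BB' : (B <= B')%N by rewrite leq_maxl.
have -> : partial_sum f A = \sum_(la <- box N B' | la \in pads) phi la.
  rewrite sumE -[RHS]big_filter; apply: perm_big; apply: uniq_perm => //.
    by rewrite filter_uniq ?box_uniq.
  by move=> la; rewrite mem_filter; case lap: (la \in pads) => //=; rewrite pads_box.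
have -> : \sum_(la <- box N B) phi la =
    \sum_(la <- box N B' | (la \in pads) && all (fun z => z < B)%N la) phi la.
  rewrite [RHS]big_mkcond (@big_box_widen _ N B B') //=; last first.
    by move=> la _ /negbTE ->; rewrite andbF.
  rewrite big_seq [RHS]big_seq; apply: eq_bigr => la lab.
  have lB : all (fun z => z < B)%N la by move: lab; rewrite mem_box => /andP[].
  rewrite lB andbT; case: ifPn => // /negP nlap.
  by apply/eqP; apply/negPn/negP => nz; apply: nlap; exact: in_pads.
rewrite [X in _ - X](bigID (fun la => all (fun z => z < B)%N la)) /= opprD addrA subrr add0r.
rewrite modulusN; apply: le_trans (modulus_sum _ _ _) _.
apply: le_trans (tail phi dphi ni B B' BB').
rewrite big_mkcond [leRHS]big_mkcond; apply: ler_sum => la _.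
by case: (la \in pads) => //=; case: ifP => // _; exact: modulus_ge0.
Qed.

End PartitionSum.

Theorem corollary7p2 (R : realType) (m n : nat) (q s : R[i])
    (x : 'I_m -> R[i]) (y : 'I_n -> R[i])
    (m_gt0 : (0 < m)%N) (n_gt0 : (0 < n)%N)
    (q_lt1 : `|q| < 1) (s_lt1 : `|s| < 1)
    (x_lt1 : forall i, `|x i| < 1) (y_lt1 : forall j, `|y j| < 1) :
  partial_sum (fun la : partition_type =>
      (spinF q s (val la) x * spinF_dual q s (val la) y) : R[i]^o) @ totally
  --> ((\prod_(i < m) \prod_(j < n)
         (qpoch_inf q (- (s * x i)) * qpoch_inf q (- (s * y j))
          / (qpoch_inf q (s ^+ 2) * qpoch_inf q (x i * y j)))) : R[i]^o).
Proof.
(* The value 0 outside the range keeps the whole family inside the unit disc. *)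
pose ext k (z : 'I_k -> R[i]) i := if insub i is Some i' then z i' else 0.
have extE k (z : 'I_k -> R[i]) (i : 'I_k) : z i = ext k z i by rewrite /ext valK.
have ext_lt1 k (z : 'I_k -> R[i]) : (forall i, `|z i| < 1) ->
    forall i, modulus (ext k z i) < 1.
  move=> z1 i; rewrite /ext; case: insub => [i'|]; last by rewrite modulus0 ltr01.
  by apply: modulus_lt1.
have x1 := ext_lt1 _ _ x_lt1; have y1 := ext_lt1 _ _ y_lt1.
(* Every partition with F nonzero has at most m parts, so it fits and leaves the last entry equal to
   0. *)
pose N := m.+1.
have [M1 [r1 [M10 r10 r11 hP _]]] := spinP_decays q_lt1 s_lt1 N m x1.
have [M2 [r2 [M20 r20 r21 _ hQ]]] := spinP_decays q_lt1 s_lt1 N n y1.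
pose phi la := spinP q s N (ext m x) m la * spinP_dual q s N (ext n y) n la.
apply: (@partition_sum_cvg R N phi _ _ (M1 * M2) r1 (mulr_ge0 M10 M20) r10 r11).
- move=> la sz; rewrite /phi modulusM mulrAC; apply: ler_pM; rewrite ?modulus_ge0 //.
    exact: hP.
  by apply: le_trans (hQ _ sz) _; rewrite ler_piMr // exprn_ile1 // ltW.
- move=> la; rewrite /phi mulf_eq0 negb_or => /andP[+ _]; exact: spinP_noninc.
- move=> p; case: ifPn => sz.
    have /andP[sp _] := valP p.
    by rewrite (spinF_spinP q s (extE m x) sz sp) (spinF_dual_spinP q_lt1 s_lt1 (extE n y) sz sp).
  rewrite (spinF_eq0 q s x (valP p)) ?mul0r //; rewrite -ltnNge in sz.
  exact: ltnW.
- have := @spinP_sum_cvg R q s q_lt1 s_lt1 N m n (ext m x) (ext n y) (leqnn _) x1 y1.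
  rewrite exchange_big /=; congr (_ @ \oo --> _).
  by apply: eq_bigr => i _; apply: eq_bigr => j _; rewrite -!extE.
Qed.
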